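(* Let $n\geq -1$ be an integer, let $X$ be a paracompact space with $\dim(X)\leq n+1$, let $E$ be a Banach space, and let $\Phi_k$, $0\leq k\leq n+1$, be a sequence of lower semi-continuous mappings from $X$ to the nonempty subsets of $E$ such that, for every $0\leq k\leq n$, the family $\{\Phi_k(x):x\in X\}$ is uniformly equi-$LC^k$ and $\Phi_k(x)\stackrel{k}{\hookrightarrow}\Phi_{k+1}(x)$ for every $x\in X$. Then $\Phi_{n+1}$ has a continuous $\varepsilon$-selection, for every $\varepsilon>0$.
   Context: All spaces are Hausdorff topological spaces; $\dim$ is covering dimension. A mapping $\Phi$ from $X$ to the nonempty subsets of $E$ is lower semi-continuous if $\{x\in X:\Phi(x)\cap U\neq\emptyset\}$ is open in $X$ for every open $U\subset E$. A map $f:X\to E$ is an $\varepsilon$-selection for $\Phi$ if for every $x\in X$ there is $y\in\Phi(x)$ with $\|f(x)-y\|<\varepsilon$. For $k\geq 0$ and subsets $S,B\subset E$, $S\stackrel{k}{\hookrightarrow}B$ means that every continuous map of the $k$-sphere into $S$ can be extended to a continuous map of the $(k+1)$-ball into $B$. For $m\geq 0$, a family $\mathscr{S}$ of nonempty subsets of a metric space is uniformly equi-$LC^m$ if for every $\varepsilon>0$ there exists $\delta(\varepsilon)>0$ such that, for every $S\in\mathscr{S}$ and every $0\leq i\leq m$, every continuous map of the $i$-sphere into $S$ whose image has diameter $<\delta(\varepsilon)$ can be extended to a continuous map of the $(i+1)$-ball into a subset of $S$ of diameter $<\varepsilon$. The metric on $E$ is the one given by its norm. *)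

(* Defs.v *)
From HB Require Import structures.
From mathcomp Require Import all_boot all_order all_algebra.
From mathcomp Require Import all_classical all_reals all_analysis.

Set Implicit Arguments.
Unset Strict Implicit.
Unset Printing Implicit Defensive.

Import Order.TTheory GRing.Theory Num.Theory.
Import numFieldNormedType.Exports.

Local Open Scope classical_set_scope.
Local Open Scope ring_scope.

Section Covers.
Context {X : topologicalType}.
Implicit Types (U V : set (set X)).

Definition open_cover U : Prop :=
  (forall A, U A -> open A) /\ \bigcup_(A in U) A = setT.

Definition refines V U : Prop :=
  forall B, V B -> exists2 A, U A & B `<=` A.

Definition locally_finite V : Prop :=
  forall x : X, exists2 W, nbhs x W & finite_set [set B | V B /\ B `&` W !=set0].

End Covers.

(* The Hausdorff axiom is not included here. *)
Definition paracompact (X : topologicalType) : Prop :=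
  forall U : set (set X), open_cover U ->
  exists V : set (set X), [/\ open_cover V, refines V U & locally_finite V].

(* dim X <= d for the Cech-Lebesgue covering dimension: every finite open cover
   has a finite open refinement of order at most d, i.e. no point lies in more
   than d + 1 of its members. *)
Definition covering_dim_le (X : topologicalType) (d : nat) : Prop :=
  forall U : set (set X), finite_set U -> open_cover U ->
  exists V : set (set X),
    [/\ finite_set V, open_cover V, refines V U &
        forall x : X, ([set B | V B /\ B x] #<= `I_d.+1)%card].

Definition mapping_lsc (X E : topologicalType) (Phi : X -> set E) : Prop :=
  forall U : set E, open U -> open [set x | Phi x `&` U !=set0].

Section SpheresAndBalls.
Context {R : realType}.

(* The topology on 'rV[R]_d is the product one, so these carry the usual
   Euclidean topology. *)
Definition sphere (k : nat) : set 'rV[R]_k.+1 :=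
  [set x | \sum_(i < k.+1) x ord0 i ^+ 2 = 1].

Definition unit_ball (d : nat) : set 'rV[R]_d :=
  [set x | \sum_(i < d) x ord0 i ^+ 2 <= 1].

Arguments sphere k _ : clear implicits.
Arguments unit_ball d _ : clear implicits.

(* A map of the k-sphere is represented by a function on the ambient space that
   is continuous for the subspace topology of the sphere; its values elsewhere
   are irrelevant. Likewise for balls. *)
Definition sphere_map (E : topologicalType) (k : nat) (S : set E)
    (f : 'rV[R]_k.+1 -> E) : Prop :=
  {within sphere k, continuous f} /\ f @` sphere k `<=` S.

Definition ball_extension (E : topologicalType) (k : nat) (B : set E)
    (f g : 'rV[R]_k.+1 -> E) : Prop :=
  [/\ {within unit_ball k.+1, continuous g},
      g @` unit_ball k.+1 `<=` B &
      forall x, sphere k x -> g x = f x].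

End SpheresAndBalls.

Arguments sphere {R} k _.
Arguments unit_ball {R} d _.

Definition sphere_extends (R : realType) (E : normedModType R) (k : nat)
    (S B : set E) : Prop :=
  forall f : 'rV[R]_k.+1 -> E, sphere_map S f -> exists g, ball_extension B f g.

Definition diam (R : realType) (E : normedModType R) (A : set E) : \bar R :=
  ereal_sup [set `|p.1 - p.2|%:E | p in A `*` A].

Definition uniformly_equi_LC (R : realType) (E : normedModType R) (m : nat)
    (SS : set (set E)) : Prop :=
  forall eps : R, 0 < eps -> exists2 delta : R, 0 < delta &
    forall S, SS S -> forall i : nat, (i <= m)%N ->
    forall f : 'rV[R]_i.+1 -> E,
      sphere_map S f -> (diam (f @` sphere i) < delta%:E)%E ->
      exists2 g, ball_extension S f g &
                 (diam (g @` unit_ball i.+1) < eps%:E)%E.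

Definition eps_selection (R : realType) (X : Type) (E : normedModType R)
    (eps : R) (Phi : X -> set E) (f : X -> E) : Prop :=
  forall x, exists2 y, Phi x y & `|f x - y| < eps.

(* Main.v *)
Require Import Defs.
From HB Require Import structures.
From mathcomp Require Import all_boot all_order all_algebra finmap.
From mathcomp Require Import all_classical all_reals all_analysis.
From mathcomp Require Import lra.

Set Implicit Arguments.
Unset Strict Implicit.
Unset Printing Implicit Defensive.

Import Order.TTheory GRing.Theory Num.Theory.
Import numFieldNormedType.Exports.

Local Open Scope classical_set_scope.
Local Open Scope ring_scope.

(** Two reductions lead to a construction over the nerve of a cover.

    Let [Psi k x] be the open [e k]-neighbourhood of [Phi k x]. By lower
    semicontinuity a compact set contained in [Psi k x] is contained in [Psi k y]
    for all [y] near [x] ([enlargement_stable]). An exact continuous selection of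
    [Psi N] with [e N = eps] is what is wanted, and the radii are chosen downwards
    from [e N], so small that a map of the [k]-sphere into [Psi k x] is
    [e k.+1]-close to a map into [Phi k x] itself. Uniform local connectedness
    provides such radii, by approximation on a fine triangulation
    ([equi_LC_sphere_approximation]). The close map extends over the ball inside
    [Phi k.+1 x], and the segments between close maps stay in [Psi k.+1 x]; hence
    the maps [Psi k] inherit the extension property ([enlargement_extends]).

    It remains to select from the stable maps [Psi k] ([stable_selection]). Were all
    [Psi k x] independent of [x], one would map the vertices of a nerve into
    [Psi 0], the edges into [Psi 1], and so on, skeleton after skeleton. Since they
    do depend on [x], the map is built in [N + 1] stages ([stage_step]). In each
    stage every point [p] becomes a vertex, and cones with this apex are filled,
    inside the sets [Psi _ p], over the finitely many simplices of the earlier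
    stages that lie around [p]; stability keeps the fillings inside [Psi _ x] for [x]
    near [p], which determines how fine the cover of this stage must be. In the
    result, a simplex of dimension [j] with one vertex in each of [j + 1] stages is
    mapped into [Psi j x] whenever [x] lies in the members of the covers that are given by its
    vertices. Finally [dim X <= N] yields a common refinement of the [N + 1] covers
    by [N + 1] disjoint families, one for each stage
    ([paracompact_coloured_refinement]). So each [x] determines a simplex with at
    most one vertex in each stage, and functions subordinate to the refinement
    determine a point of that simplex, whose image is the value of the selection.

    A point of a simplex is a function on the set of all vertices whose maximum,
    instead of its sum, is 1. Points of such a simplex are obtained from bump
    functions by evaluation, without sums over infinite index sets. *)

(** * Paracompact spaces *)

Lemma filter_finite_set (T I : Type) (F : set_system T) (S : set I)
    (P : I -> set T) : Filter F -> finite_set S ->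
  (forall i, S i -> F (P i)) -> F [set x | forall i, S i -> P i x].
Proof.
move=> FF finS FP.
have /finite_fsetP[D SD] : finite_set (S : set {classic I}) by [].
have : F (\bigcap_(i in [set` D]) P i).
  by apply: filter_bigI => i iD; apply: FP; rewrite SD.
by apply: filterS => x Dx i Si; apply: Dx; rewrite -SD.
Qed.

Definition locally_finite_family (I : Type) (X : topologicalType)
    (V : I -> set X) : Prop :=
  forall x : X, exists2 W, nbhs x W & finite_set [set i | V i `&` W !=set0].

Section Paracompact.
Context {X : topologicalType}.

Lemma closure_bigcup_locally_finite (I : Type) (D : set I) (V : I -> set X) :
  (forall x : X, exists2 W, nbhs x W &
    finite_set [set i | D i /\ V i `&` W !=set0]) ->
  closure (\bigcup_(i in D) V i) `<=` \bigcup_(i in D) closure (V i).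
Proof.
move=> lfV x clx; apply: contrapT => nx.
have [W Wx finW] := lfV x.
have : nbhs x [set y | forall i, [set i | D i /\ V i `&` W !=set0] i ->
    (~` closure (V i)) y].
  apply: filter_finite_set => // i [Di _].
  apply: open_nbhs_nbhs; split; first exact/closed_openC/closed_closure.
  by move=> Vix; apply: nx; exists i.
move=> /(filterI Wx) /clx [y [[i Di Viy] [Wy]]] /(_ i); apply.
- by split=> //; exists y.
- exact: subset_closure.
Qed.

Lemma locally_finite_closure (I : Type) (V : I -> set X) :
  locally_finite_family V -> locally_finite_family (fun i => closure (V i)).
Proof.
move=> lfV x; have [W Wx finW] := lfV x; exists W°; first exact: nbhs_interior.
apply: sub_finite_set finW => i [y [clVy Wy]].
exact: clVy.
Qed.

Hypothesis paraX : paracompact X.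

(** Regularity and normality both come from this: separation of the points of [B]
    from [A] globalizes, because the closure of a locally finite union is the union
    of the closures. *)
Lemma paracompact_separation (A B : set X) : closed B ->
  (forall b, B b -> exists2 G, open G /\ G b & closure G `&` A = set0) ->
  exists G, [/\ open G, B `<=` G & closure G `&` A = set0].
Proof.
move=> clB sepB.
pose U := [set G | open G /\ (closure G `&` A = set0 \/ G = ~` B)].
have Ucov : open_cover U.
  split; first by move=> G [].
  rewrite eqEsubset; split=> // x _; have [Bx|nBx] := pselect (B x).
    by have [G [oG Gx] GA] := sepB _ Bx; exists G => //; split=> //; left.
  by exists (~` B) => //; split; [exact: closed_openC | right].
have [V [[oV covV] refV lfV]] := paraX Ucov.
pose D := [set G | V G /\ G `&` B !=set0].
have DA G : D G -> closure G `&` A = set0.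
  move=> [VG [x [Gx Bx]]]; have [G' [_ [G'A|G'B]] GG'] := refV _ VG; last first.
    by have := GG' _ Gx; rewrite G'B.
  by rewrite -subset0 -G'A; apply: setSI; exact: closureS.
exists (\bigcup_(G in D) G); split.
- by apply: bigcup_open => G [/oV].
- move=> x Bx; have : (\bigcup_(A0 in V) A0) x by rewrite covV.
  by move=> [G VG Gx]; exists G => //; split=> //; exists x.
- rewrite -subset0 => x [clx Ax].
  have [|G DG clG] := closure_bigcup_locally_finite _ clx; last first.
    by rewrite -(DA _ DG); split.
  move=> y; have [W Wy finW] := lfV y; exists W => //.
  by apply: sub_finite_set finW => G [[VG _] GW].
Qed.

Hypothesis hausX : hausdorff_space X.

Lemma paracompact_regular (x : X) (W : set X) : nbhs x W ->
  exists G, [/\ open G, G x & closure G `<=` W].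
Proof.
move=> Wx.
have clB : closed (~` W°) by apply: open_closedC; exact: open_interior.
have [b Bb|G [oG BG Gx]] := @paracompact_separation [set x] (~` W°) clB.
  have xb : x != b by apply/eqP => xb; apply: Bb; rewrite -xb.
  have := hausX; rewrite open_hausdorff => /(_ _ _ xb).
  move=> [[P Q] /= [/set_mem Px /set_mem Qb] [oP oQ /eqP PQ]].
  exists Q => //; rewrite -subset0 => y [clQ yx]; rewrite {}yx in clQ *.
  have [z [Qz Pz]] := clQ _ (open_nbhs_nbhs (conj oP Px)).
  by have : (P `&` Q) z by []; rewrite PQ.
exists (~` closure G); split.
- exact/closed_openC/closed_closure.
- by move=> clx; rewrite -[False]/(set0 x) -Gx; split.
- have clGc : closed (~` G) by exact: open_closedC.
  apply: (@subset_trans _ (~` G)).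
    by have /closure_id -> := clGc; apply: closureS; apply: subsetC; exact: subset_closure.
  by move=> y nGy; apply: contrapT => nWy; apply: nGy; apply: BG => /interior_subset.
Qed.

Lemma paracompact_normal : normal_space X.
Proof.
move=> A clA W AW.
have clB : closed (~` W°) by apply: open_closedC; exact: open_interior.
have [b Bb|G [oG BG GA]] := @paracompact_separation A (~` W°) clB.
  have nAb : nbhs b (~` A).
    apply: open_nbhs_nbhs; split; first exact: closed_openC.
    by move=> Ab; apply: Bb; exact: AW.
  have [G [oG Gb GA]] := paracompact_regular nAb.
  by exists G => //; exact/disjoints_subset.
exists (~` closure G).
  apply/set_nbhsP; exists (~` closure G); split=> //.
    exact/closed_openC/closed_closure.
  by apply/disjoints_subset; rewrite setIC.
have clGc : closed (~` G) by exact: open_closedC.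
apply: (@subset_trans _ (~` G)).
  by have /closure_id -> := clGc; apply: closureS; apply: subsetC; exact: subset_closure.
by move=> y nGy; apply: contrapT => nWy; apply: nGy; apply: BG => /interior_subset.
Qed.

(** Refinements that keep the index set of the cover: a member of a locally finite
    refinement is assigned to one index, and the members with the same index are
    united. Local finiteness keeps the closures under control. *)
Lemma paracompact_indexed_refinement (I : Type) (W : I -> set X) :
  (forall i, open (W i)) -> (forall x, exists i, W i x) ->
  exists V : I -> set X, [/\ forall i, open (V i), forall x, exists i, V i x,
    forall i, closure (V i) `<=` W i & locally_finite_family V].
Proof.
move=> oW covW.
pose U := [set G | open G /\ exists i, closure G `<=` W i].
have Ucov : open_cover U.
  split; first by move=> G [].
  rewrite eqEsubset; split=> // x _; have [i Wix] := covW x.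
  have [G [oG Gx GW]] := paracompact_regular (open_nbhs_nbhs (conj (oW i) Wix)).
  by exists G => //; split=> //; exists i.
have [V [[oV covV] refV lfV]] := paraX Ucov.
have /choice[s sP] : forall G, exists oi : option I, V G ->
    exists2 i, oi = Some i & closure G `<=` W i.
  move=> G; have [VG|nVG] := pselect (V G); last by exists None.
  have [G' [_ [i G'i]] GG'] := refV _ VG; exists (Some i) => _; exists i => //.
  exact: (subset_trans (closureS GG')).
exists (fun i => \bigcup_(G in [set G | V G /\ s G = Some i]) G); split.
- by move=> i; apply: bigcup_open => G [/oV].
- move=> x; have : (\bigcup_(A0 in V) A0) x by rewrite covV.
  move=> [G VG Gx]; have [i si _] := sP _ VG.
  by exists i, G.
- move=> i x clx; have [|G [VG sG] clG] := closure_bigcup_locally_finite _ clx.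
    move=> y; have [N Ny finN] := lfV y; exists N => //.
    by apply: sub_finite_set finN => G [[VG _] GN].
  by have [j] := sP _ VG; rewrite sG => -[<-]; apply.
- move=> x; have [i0 _] := covW x; have [N Nx finN] := lfV x; exists N => //.
  apply: sub_finite_set (finite_image (fun G => odflt i0 (s G)) finN).
  move=> i [y [[G [VG sG] Gy] Ny]]; exists G; last by rewrite sG.
  by split=> //; exists y.
Qed.

(** A locally finite cover carries functions that are supported in its members
    and one of which equals 1 at each point. This normalization by the maximum
    plays the part of a partition of unity and avoids sums over the index set. *)
Lemma paracompact_bump_functions (R : realType) (I : Type) (U : I -> set X) :
  (forall i, open (U i)) -> (forall x, exists i, U i x) ->
  exists l : I -> X -> R, [/\ forall i, continuous (l i),
    forall i x, 0 <= l i x <= 1, forall i x, 0 < l i x -> U i x &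
    forall x, exists i, l i x = 1].
Proof.
move=> oU covU.
have [V [oV covV VU _]] := paracompact_indexed_refinement oU covU.
have /choice[l lP] : forall i, exists l : X -> R, [/\ continuous l,
    range l `<=` `[0, 1], l @` (~` U i) `<=` [set 0] &
    l @` closure (V i) `<=` [set 1]].
  move=> i; apply/uniform_separatorP; apply: (@normal_uniform_separator _ paracompact_normal).
  - exact: open_closedC.
  - exact: closed_closure.
  - by rewrite setIC; apply/disjoints_subset; rewrite setCK.
exists l; split.
- by move=> i; case: (lP i).
- move=> i x; case: (lP i) => _ l01 _ _.
  by have := l01 (l i x) (ex_intro2 _ _ x Logic.I erefl); rewrite /= in_itv.
- move=> i x; case: (lP i) => _ _ l0 _ lx; apply: contrapT => nUx.
  by have := l0 (l i x) (ex_intro2 _ _ x nUx erefl) => /= l00; rewrite l00 ltxx in lx.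
- move=> x; have [i Vix] := covV x; exists i; case: (lP i) => _ _ _; apply.
  by exists x => //; exact: subset_closure.
Qed.

End Paracompact.

(** * Covering dimension *)

Definition order_le (I : choiceType) (X : Type) (n : nat) (Q : I -> set X) :=
  forall (x : X) (D : {fset I}), (forall i, i \in D -> Q i x) -> (#|` D| <= n)%N.

Section Dimension.
Context {X : topologicalType} {N : nat}.
Hypothesis dimX : covering_dim_le X N.

(** The dimension hypothesis speaks about finite covers; it is applied here to
    the cover formed by [P 0], ..., [P m] and the union of the remaining members,
    and only the trace of its refinement on [A] is kept. *)
Lemma shrink_order_on_closed (P : nat -> set X) (A : set X) (m : nat) :
  (forall i, open (P i)) -> (forall x, exists i, P i x) ->
  closed A -> (forall j, (m < j)%N -> P j `&` A = set0) ->
  exists P' : nat -> set X, [/\ forall i, open (P' i), forall x, exists i, P' i x,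
    forall i, P' i `<=` P i, forall i x, ~ A x -> P i x -> P' i x &
    forall x (D : {fset nat}), A x -> (forall i, i \in D -> P' i x) ->
      (#|` D| <= N.+1)%N].
Proof.
move=> oP covP clA PA.
pose rest := \bigcup_(j in [set j | (m < j)%N]) P j.
pose U := [set P i | i in `I_m.+1] `|` [set rest].
have finU : finite_set U.
  rewrite finite_setU; split; first exact/finite_image/finite_II.
  exact: finite_set1.
have Ucov : open_cover U.
  split.
    by move=> _ [[i _ <-]|->] //; apply: bigcup_open.
  rewrite eqEsubset; split=> // x _; have [i Pix] := covP x.
  have [im|mi] := leqP i m; first by exists (P i) => //; left; exists i.
  by exists rest; [right | exists i].
have [V [finV [oV covV] refV ordV]] := dimX finU Ucov.
have /choice[c cP] : forall B, exists i, V B ->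
    ((i <= m)%N /\ B `<=` P i) \/ (i = m.+1 /\ B `<=` rest).
  move=> B; have [VB|nVB] := pselect (V B); last by exists 0%N.
  have [A' [[i im <-]|->] BA'] := refV _ VB.
    by exists i => _; left.
  by exists m.+1 => _; right.
pose W i := \bigcup_(B in [set B | V B /\ c B = i]) B.
have WP i x : (i <= m)%N -> W i x -> P i x.
  move=> im [B [VB cB] Bx]; have [[_]|[ci _]] := cP _ VB.
    by rewrite cB; apply.
  by move: im; rewrite -cB ci ltnn.
exists (fun i => (P i `\` A) `|` (if (i <= m)%N then W i else set0)); split.
- move=> i; apply: openU; first by apply: openI => //; exact: closed_openC.
  by case: ifP => _; [apply: bigcup_open => B [/oV] | exact: open0].
- move=> x; have [Ax|nAx] := pselect (A x); last first.
    by have [i Pix] := covP x; exists i; left.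
  have : (\bigcup_(B in V) B) x by rewrite covV.
  move=> [B VB Bx]; have [[cm _]|[_ Brest]] := cP _ VB.
    by exists (c B); right; rewrite cm; exists B.
  have [j mj Pjx] := Brest _ Bx.
  by have : (P j `&` A) x by []; rewrite PA.
- by move=> i x [[]//|]; case: ifP => // im; exact: WP.
- by move=> i x nAx Pix; left.
- move=> x D Ax DP'.
  have DW i : i \in D -> (i <= m)%N /\ W i x.
    by move=> /DP' [[]//|]; case: ifP.
  have D_le : ([set` D] #<= `I_N.+1)%card.
    apply: card_le_trans (ordV x); apply: card_le_trans (card_image_le c _).
    apply: subset_card_le => i /DW [im [B [VB cB] Bx]].
    by exists B.
  by rewrite -(set_fsetK D); apply: geq_card_fset_set.
Qed.

(** Countable sum argument. Let [L i] be the closed set of the points that lie in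
    no [O j] with [j >= i]. The order is corrected successively on the closed sets
    [L m.+1 `\` (L m)°], which form a locally finite cover of [X]; each point has a
    neighbourhood where only finitely many steps have an effect, so that the
    intersection of the successive shrinkings is still open. *)
Lemma countable_cover_shrink_order (O : nat -> set X) :
  (forall i, open (O i)) -> (forall x, exists i, O i x) ->
  locally_finite_family O ->
  exists Q : nat -> set X, [/\ forall i, open (Q i), forall x, exists i, Q i x,
    forall i, Q i `<=` O i & order_le N.+1 Q].
Proof.
move=> oO covO lfO.
pose L i := ~` \bigcup_(j in [set j | (i <= j)%N]) O j.
have clL i : closed (L i) by apply: open_closedC; apply: bigcup_open.
have leL i j : (i <= j)%N -> L i `<=` L j.
  by move=> ij x nLx [k /= jk Ok]; apply: nLx; exists k => //=; exact: leq_trans jk.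
have covL x : exists q, (L q)° x.
  have [W Wx /finite_fsetP[D WD]] := lfO x.
  exists (\max_(i <- D) i).+1; apply: filterS Wx => y Wy [j /= qj Ojy].
  have jD : [set` D] j by rewrite -WD; exists y.
  by have := @leq_bigmax_seq _ (enum_fset D) xpredT id j jD isT; rewrite leqNgt qj.
pose A m := L m.+1 `\` (L m)°.
have clA m : closed (A m) by apply: closedI => //; apply: open_closedC; exact: open_interior.
pose good (P : nat -> set X) := [/\ forall i, open (P i),
  forall x, exists i, P i x & forall i, P i `<=` O i].
have /choice[S SP] : forall mP : nat * (nat -> set X), exists P' : nat -> set X,
  good mP.2 -> [/\ good P', forall i, P' i `<=` mP.2 i,
    forall i x, ~ A mP.1 x -> mP.2 i x -> P' i x &
    forall x (D : {fset nat}), A mP.1 x -> (forall i, i \in D -> P' i x) ->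
      (#|` D| <= N.+1)%N].
  move=> [m P] /=; have [[oP covP PO]|nP] := pselect (good P); last by exists P.
  have PA j : (m < j)%N -> P j `&` A m = set0.
    move=> mj; rewrite -subset0 => x [Pjx [Lx _]]; apply: Lx.
    by exists j => //; exact: PO.
  have [P' [? ? P'P ? ?]] := shrink_order_on_closed oP covP (clA m) PA.
  exists P' => _; split=> //; rewrite /good; split=> // i.
  exact: subset_trans (P'P i) (PO i).
pose P := fix P m := if m is m'.+1 then S (m', P m') else O.
have gP m : good (P m).
  elim: m => [|m gm]; first by split=> // i x.
  by have [] := SP (m, P m) gm.
have decP m k i : P (m + k)%N i `<=` P m i.
  elim: k => [|k ih]; first by rewrite addn0.
  rewrite addnS; apply: subset_trans ih.
  by have [_ + _ _] := SP ((m + k)%N, P (m + k)%N) (gP _); apply.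
have stabP q x m i : (L q)° x -> (q <= m)%N -> P q i x -> P m i x.
  move=> Lqx /subnKC <-; elim: (m - q)%N => [|k ih]; first by rewrite addn0.
  rewrite addnS => /ih Pi; have [_ _ + _] := SP ((q + k)%N, P (q + k)%N) (gP _); apply=> //.
  move=> [_]; apply; have : (L q)° `<=` (L (q + k)%N)°.
    by apply: interiorS; apply: leL; exact: leq_addr.
  exact.
pose Q i := \bigcap_m P m i.
have QP q x i : (L q)° x -> P q i x -> Q i x.
  move=> Lqx Pqi m _; have [qm|/ltnW mq] := leqP q m; first exact: (stabP q).
  by apply: (decP m (q - m)%N); rewrite subnKC.
exists Q; split.
- move=> i; rewrite openE => x Qix; have [q Lqx] := covL x.
  have [oPq _ _] := gP q.
  have : nbhs x ((L q)° `&` P q i).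
    apply: open_nbhs_nbhs; split; last by split=> //; exact: Qix.
    by apply: openI => //; exact: open_interior.
  by apply: filterS => y [Ly Py]; exact: (QP q).
- move=> x; have [q Lqx] := covL x; have [_ /(_ x)[i Pi] _] := gP q.
  by exists i; exact: (QP q).
- by move=> i x /(_ 0%N); apply.
- move=> x D DQ.
  have exL : exists m, `[< L m.+1 x >].
    have [q /interior_subset Lqx] := covL x; exists q; apply/asboolP.
    by apply: (leL q).
  pose m := ex_minn exL.
  have Am : A m x.
    rewrite /m; case: ex_minnP => n /asboolP Ln nmin; split=> //.
    move=> /interior_subset; case: n Ln nmin => [|n] Ln nmin.
      by move=> L0; have [i Oix] := covO x; apply: L0; exists i.
    by move=> /asboolP /nmin; rewrite ltnn.
  have [_ _ _ /(_ x D Am)] := SP (m, P m) (gP m); apply.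
  by move=> i /DQ /(_ m.+1); apply.
Qed.

End Dimension.

Section Barycentric.
Context {X : topologicalType} {R : realType} {I : choiceType}.
Variable l : I -> X -> R.

(** The open star of the barycentre of the simplex [s] in the barycentric
    subdivision of the nerve on which the [l i] are coordinates. *)
Definition barycentric_star (s : {fset I}) : set X :=
  [set x | (forall i, i \in s -> 0 < l i x) /\
    forall i j, i \in s -> j \notin s -> l j x < l i x].

Lemma barycentric_star_disjoint (s s' : {fset I}) (x : X) :
  #|` s| = #|` s'| -> barycentric_star s x -> barycentric_star s' x -> s = s'.
Proof.
move=> ss' [_ sx] [_ s'x]; apply/eqP; apply: contrapT => /negP ns.
have /fsubsetPn[i si s'i] : ~~ (s `<=` s')%fset.
  by apply/negP => /fsubset_cardP E; apply: (negP ns); apply/eqP/fsetP/E.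
have /fsubsetPn[j s'j sj] : ~~ (s' `<=` s)%fset.
  by apply/negP => /fsubset_cardP E; apply: (negP ns); rewrite eq_sym; apply/eqP/fsetP/E.
by have := lt_trans (sx _ _ si sj) (s'x _ _ s'j s'i); rewrite ltxx.
Qed.

Hypothesis lc : forall i, continuous (l i).
Hypothesis lf : locally_finite_family (fun i => [set x | 0 < l i x]).

Lemma barycentric_star_open (s : {fset I}) : open (barycentric_star s).
Proof.
rewrite openE => x [sx sx'].
have [W Wx finW] := lf x.
pose T := [set i | [set x | 0 < l i x] `&` W !=set0].
have n1 : nbhs x [set y | forall i, i \in s -> 0 < l i y].
  apply: (@filter_finite_set _ _ _ [set` s]); first exact: finite_fset.
  by move=> i /= si; exact: (cvgr_gt _ (@lc i x) _ (sx i si)).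
have n2 : nbhs x [set y | forall ij, ([set` s] `*` T) ij -> ij.2 \notin s -> l ij.2 y < l ij.1 y].
  apply: filter_finite_set; first by apply: finite_setX => //; exact: finite_fset.
  move=> [i j] [/= si Tj]; have [js|js] := boolP (j \in s); first by near=> y.
  near=> y => _; rewrite -subr_gt0; near: y.
  have /cvgr_gt : (fun y => l i y - l j y) @ x --> l i x - l j x.
    by apply: cvgB; exact: lc.
  by apply; rewrite subr_gt0; exact: sx'.
near=> y; split; first by near: y.
move=> i j si js; have [lj|lj] := ltP 0 (l j y); last first.
  by apply: (le_lt_trans lj); move: i si; near: y.
have ij : ([set` s] `*` T) (i, j).
  by split=> //; exists y; split=> //; near: y.
have : forall ij, ([set` s] `*` T) ij -> ij.2 \notin s -> l ij.2 y < l ij.1 y.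
  by near: y.
by move=> /(_ _ ij js).
Unshelve. all: by end_near. Qed.

Hypothesis l_le1 : forall i x, l i x <= 1.
Hypothesis l1 : forall x, exists i, l i x = 1.

Lemma barycentric_star_cover (x : X) :
  exists2 s, barycentric_star s x & (0 < #|` s|)%N.
Proof.
have [W Wx finW] := lf x.
have finS : finite_set [set i | l i x = 1].
  apply: sub_finite_set finW => i /= lix; exists x; split=> /=.
    by rewrite lix.
  exact: nbhs_singleton.
have memS i : (i \in fset_set [set i | l i x = 1]) <-> l i x = 1.
  by rewrite in_fset_set//; split=> [/set_mem|/mem_set].
exists (fset_set [set i | l i x = 1]).
  split=> [i /memS -> //|i j /memS -> /negP nj].
  rewrite lt_neqAle l_le1 andbT; apply/eqP => lj.
  exact/nj/memS.
have [i li] := l1 x.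
by rewrite cardfs_gt0; apply/fset0Pn; exists i; exact/memS.
Qed.

End Barycentric.

(** A cover of a paracompact space of dimension at most [N] is refined by [N + 1]
    disjoint open families. The barycentric stars of a locally finite cover form
    countably many disjoint families, one for each dimension of a simplex. The
    countable cover by the unions of these families can be shrunk to a cover of
    order at most [N + 1], whose barycentric stars in turn have only [N + 1]
    possible dimensions. *)
Lemma paracompact_coloured_refinement (R : realType) (X : topologicalType)
    (N : nat) (J : choiceType) (W : J -> set X) :
  hausdorff_space X -> paracompact X -> covering_dim_le X N ->
  (forall j, open (W j)) -> (forall x, exists j, W j x) ->
  exists G : nat -> J -> set X, [/\ forall c j, open (G c j),
    forall c j, G c j `<=` W j,
    forall c j j' x, G c j x -> G c j' x -> j = j' &
    forall x, exists2 c, (c <= N)%N & exists j, G c j x].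
Proof.
move=> hausX paraX dimX oW covW.
have [V [oV covV VW lfV]] := paracompact_indexed_refinement paraX hausX oW covW.
have [l [lc l01 lV l1]] := paracompact_bump_functions paraX hausX R oV covV.
have l_le1 j x : l j x <= 1 by case/andP: (l01 j x).
have lfl : locally_finite_family (fun j => [set x | 0 < l j x]).
  move=> x; have [A Ax finA] := lfV x; exists A => //.
  by apply: sub_finite_set finA => j [y [/= /lV Vjy Ay]]; exists y.
pose star := barycentric_star l.
pose O i := \bigcup_(s in [set s : {fset J} | #|` s| = i.+1]) star s.
have oO i : open (O i).
  by apply: bigcup_open => s _; exact: barycentric_star_open.
have covO x : exists i, O i x.
  have [s sx] := barycentric_star_cover lfl l_le1 l1 x.
  by move=> s0; exists (#|` s|.-1); exists s => //=; rewrite prednK.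
have lfO : locally_finite_family O.
  move=> x; have [A Ax finA] := lfl x; exists A => //.
  pose D := fset_set [set j | [set x | 0 < l j x] `&` A !=set0].
  apply: sub_finite_set (finite_II #|` D|) => i [y [[s /= si [sy _]] Ay]].
  rewrite /= -si; apply/fsubset_leq_card/fsubsetP => j js.
  by rewrite in_fset_set//; apply/mem_set; exists y; split=> //; exact: sy.
have [Q [oQ covQ QO ordQ]] := countable_cover_shrink_order dimX oO covO lfO.
have [m [mc m01 mQ m1]] := paracompact_bump_functions paraX hausX R oQ covQ.
have m_le1 i x : m i x <= 1 by case/andP: (m01 i x).
have lfm : locally_finite_family (fun i => [set x | 0 < m i x]).
  move=> x; have [A Ax finA] := lfO x; exists A => //.
  by apply: sub_finite_set finA => i [y [/= /mQ /QO Oiy Ay]]; exists y.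
pose star' := barycentric_star m.
pose first (T : choiceType) (s : {fset T}) := ohead (enum_fset s).
have firstP (T : choiceType) (s : {fset T}) : (0 < #|` s|)%N ->
    exists2 i, first T s = Some i & i \in s.
  rewrite /first => s0; have : size (enum_fset s) != 0%N by rewrite -lt0n.
  have : forall i, i \in enum_fset s -> i \in s by [].
  by case: (enum_fset s) => //= i t sub _; exists i => //; apply: sub; rewrite inE eqxx.
exists (fun c j => \bigcup_(ts in [set ts : {fset nat} * {fset J} |
    [/\ #|` ts.1| = c.+1, omap S (first _ ts.1) = Some #|` ts.2| &
        first _ ts.2 = Some j]]) (star' ts.1 `&` star ts.2)); split.
- move=> c j; apply: bigcup_open => -[t s] _; apply: openI; exact: barycentric_star_open.
- move=> c j x [[t s] [/= _ ts sj] [_ [sx _]]].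
  have [|j'] := firstP _ s; first by case: (first _ t) ts => //= ? [<-].
  rewrite sj => -[<-] js; apply: VW; apply: subset_closure; apply: lV.
  exact: sx.
- move=> c j j' x [[t s] [/= tc ts sj] [tx sx]] [[t' s'] [/= tc' ts' sj'] [tx' sx']].
  have tt' : t = t' by apply: barycentric_star_disjoint tx tx'; rewrite tc tc'.
  move: ts'; rewrite -tt' ts => -[ss].
  have ss' := barycentric_star_disjoint ss sx sx'.
  by move: sj'; rewrite -ss' sj => -[].
- move=> x; have [t tx t0] := barycentric_star_cover lfm m_le1 m1 x.
  have [i ti it] := firstP _ _ t0.
  have [s si sx] : O i x by apply: QO; apply: mQ; case: tx => + _; apply.
  have [j sj js] : exists2 j, first _ s = Some j & j \in s.
    by apply: firstP; rewrite si.
  exists (#|` t|.-1).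
    rewrite -ltnS prednK//; apply: (ordQ x) => k kt.
    by apply: mQ; case: tx => + _; apply.
  exists j, (t, s) => //; split=> //=; first by rewrite prednK.
  by rewrite ti si.
Qed.

(** * Simplices and balls *)

Lemma cvg_pointwise (U V : Type) (W : topologicalType) (F : set_system U)
    (f : U -> {ptws V -> W}) (g : {ptws V -> W}) : Filter F ->
  (forall v, f u v @[u --> F] --> g v) -> f @ F --> g.
Proof.
move=> FF fg; apply/cvg_sup => v A [_ [[B oB <-] Bg] BA].
apply: filterS BA _.
exact: (fg v B (open_nbhs_nbhs (conj oB Bg))).
Qed.

Lemma ptws_eval_continuous (V : eqType) (W : topologicalType) (v : V) :
  continuous (fun t : {ptws V -> W} => t v).
Proof. exact: (@proj_continuous V (fun=> W) v). Qed.

Lemma cvg_row (U : Type) (R : realType) n (F : set_system U)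
    (f : U -> 'rV[R]_n) (l : 'rV[R]_n) : Filter F ->
  (forall j, f u ord0 j @[u --> F] --> l ord0 j) -> f @ F --> l.
Proof.
move=> FF fl; apply/cvg_ballP => e e0; near=> u; split=> // i j.
rewrite ord1; move: j; near: u; apply: filter_forall => j.
by have /cvg_ballP/(_ e e0) := fl j.
Unshelve. all: by end_near. Qed.

Section Cell.
Context {R : realType} {V : choiceType}.
Implicit Types (s : {fset V}) (t : {ptws V -> R}).

(** The simplex with vertex set [s], in coordinates normalized by their maximum
    rather than by their sum. *)
Definition cell s : set {ptws V -> R} :=
  [set t | [/\ forall v, 0 <= t v <= 1, forall v, v \notin s -> t v = 0 &
               exists2 v, v \in s & t v = 1]].

Definition cell_boundary s : set {ptws V -> R} :=
  cell s `&` [set t | exists2 v, v \in s & t v = 0].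

Lemma cellS s s' : (s `<=` s')%fset -> cell s `<=` cell s'.
Proof.
move=> ss' t [t01 ts [v vs tv]]; split=> //.
  by move=> w ws'; apply: ts; apply: contra ws'; exact: (fsubsetP ss').
by exists v => //; exact: (fsubsetP ss').
Qed.

Lemma cell_boundaryP s t : cell_boundary s t <->
  exists2 v, v \in s & cell (s `\ v)%fset t.
Proof.
split=> [[[t01 ts [w ws tw]] [v vs tv]]|[v vs tsv]].
  exists v => //; split=> //.
    by move=> u; rewrite !inE negb_and negbK => /orP[/eqP ->|/ts].
  exists w => //; rewrite !inE ws andbT; apply/eqP => wv.
  by move: tw; rewrite wv tv => /eqP; rewrite eq_sym oner_eq0.
split; first by apply: cellS tsv; exact: fsubD1set.
by exists v => //; case: tsv => _ + _; apply; rewrite !inE eqxx.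
Qed.

Lemma cell_closed s : closed (cell s).
Proof.
have -> : cell s = (\bigcap_v [set t : {ptws V -> R} | 0 <= t v <= 1]) `&`
    (\bigcap_(v in [set v | v \notin s]) [set t : {ptws V -> R} | t v = 0]) `&`
    \bigcup_(v in [set` s]) [set t : {ptws V -> R} | t v = 1].
  apply/seteqP; split=> [t [t01 ts [v vs tv]]|t [[t01 ts] [v vs tv]]].
    by split; [split=> // w _; exact: t01 | exists v].
  by split; [move=> w; exact: t01 | move=> w; exact: ts | exists v].
have cl1 v (c : R) : closed [set t : {ptws V -> R} | t v = c].
  have -> : [set t : {ptws V -> R} | t v = c] = (fun t : {ptws V -> R} => t v) @^-1` [set c] by [].
  by apply: closed_comp; [move=> t _; exact: ptws_eval_continuous | exact: closed_eq].
apply: closedI; first apply: closedI.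
- apply: closed_bigI => v _.
  have -> : [set t : {ptws V -> R} | 0 <= t v <= 1] =
      (fun t : {ptws V -> R} => t v) @^-1` `[0, 1]%classic.
    by apply/seteqP; split=> t /=; rewrite in_itv.
  by apply: closed_comp; [move=> t _; exact: ptws_eval_continuous | exact: interval_closed].
- by apply: closed_bigI => v _; exact: cl1.
- apply: closed_bigcup => [|v _]; [exact: finite_fset | exact: cl1].
Qed.

Lemma cell_compact s : compact (cell s).
Proof.
apply: (@subclosed_compact _ _ [set t : {ptws V -> R} | forall v, `[0, 1]%classic (t v)]).
- exact: cell_closed.
- by apply: (@tychonoff V (fun=> R) (fun=> `[0, 1]%classic)) => v; exact: segment_compact.
- by move=> t [t01 _ _] v /=; rewrite in_itv /=.
Qed.

Section BallParametrization.
Context {k : nat} {s : {fset V}}.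
Hypothesis cards : #|` s| = k.+2.

Implicit Types y : 'rV[R]_k.+1.

(* A row vector is completed by a zero in last position; the simplex, up to
   translation along (1, ..., 1), is read off from the differences to the last
   coordinate. *)
Let ext y (i : 'I_k.+2) : R := oapp (y ord0) 0 (unlift ord_max i).
Let hi y : R := \big[Num.max/0]_i ext y i.
Let lo y : R := \big[Num.min/0]_i ext y i.
Let norm2 y : R := Num.sqrt (\sum_i y ord0 i ^+ 2).

Let ext_continuous i : continuous (ext^~ i).
Proof.
rewrite /ext; case: (unlift ord_max i) => [j|] /=; first exact: coord_continuous.
exact: cst_continuous.
Qed.

Let hi_continuous : continuous hi.
Proof.
move=> y; apply: cvg_big => [||i _]; first exact: max_continuous.
  exact: nbhs_filter.
exact: ext_continuous.
Qed.

Let lo_continuous : continuous lo.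
Proof.
move=> y; apply: cvg_big => [||i _]; first exact: min_continuous.
  exact: nbhs_filter.
exact: ext_continuous.
Qed.

Let norm2_continuous : continuous norm2.
Proof.
move=> y; apply: continuous_comp; last exact: sqrt_continuous.
apply: cvg_big => [||i _]; [exact: add_continuous | exact: nbhs_filter | ].
by apply: cvgM; (exact: nbhs_filter || exact: coord_continuous).
Qed.

Let hi_ge y i : ext y i <= hi y. Proof. exact: le_bigmax. Qed.
Let lo_le y i : lo y <= ext y i. Proof. exact: bigmin_le. Qed.

Let ext_last y : ext y ord_max = 0. Proof. by rewrite /ext unlift_none. Qed.
Let ext_lift y j : ext y (lift ord_max j) = y ord0 j.
Proof. by rewrite /ext liftK. Qed.

Let hi_ge0 y : 0 <= hi y. Proof. by rewrite -(ext_last y). Qed.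
Let lo_le0 y : lo y <= 0. Proof. by rewrite -(ext_last y). Qed.

Let hi_ex y : exists i, hi y = ext y i.
Proof.
rewrite /hi; elim/big_ind : _ => [|a b [i ->] [j ->]|i _].
- by exists ord_max; rewrite ext_last.
- by rewrite maxEle; case: ifP => _; [exists j | exists i].
- by exists i.
Qed.

Let lo_ex y : exists i, lo y = ext y i.
Proof.
rewrite /lo; elim/big_ind : _ => [|a b [i ->] [j ->]|i _].
- by exists ord_max; rewrite ext_last.
- by rewrite minEle; case: ifP => _; [exists i | exists j].
- by exists i.
Qed.

Let osc_gt0 y j : y ord0 j != 0 -> 0 < hi y - lo y.
Proof.
move=> yj; rewrite subr_gt0 lt_neqAle (le_trans (lo_le0 y))// andbT.
apply/eqP => E; move/eqP: yj; apply; apply/eqP; rewrite -ext_lift eq_le.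
have h0 : hi y <= 0 by rewrite -E.
have l0 : 0 <= lo y by rewrite E.
by rewrite (le_trans _ h0)//= (le_trans l0).
Qed.

Let e (i : 'I_k.+2) : V := tnth (Tuple (introT eqP cards)) i.

Let e_in i : e i \in s. Proof. exact: mem_tnth. Qed.

Let idx v : 'I_k.+2 := inord (index v (enum_fset s)).

Let idxK v : v \in s -> e (idx v) = v.
Proof.
move=> vs; rewrite /e (tnth_nth v) /= inordK ?nth_index//.
by rewrite -cards index_mem.
Qed.

Let eK i : idx (e i) = i.
Proof.
apply/val_inj; rewrite /= /idx /e (tnth_nth (e i)) /= index_uniq ?inord_val//.
by rewrite cards.
Qed.

(* The affine rescaling makes the extreme coordinates 0 and 1. *)
Let from_ball y : {ptws V -> R} := fun v =>
  if v \in s then (ext y (idx v) - lo y) / (hi y - lo y) else 0.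

Let differences (t : {ptws V -> R}) : 'rV[R]_k.+1 :=
  \row_j (t (e (lift ord_max j)) - t (e ord_max)).

(* On the boundary of the simplex the oscillation [hi - lo] is 1, so that the
   denominator is the Euclidean norm; elsewhere it is positive, even where all
   differences vanish. *)
Let to_ball t : 'rV[R]_k.+1 :=
  (Num.max (norm2 (differences t))
    (1 - (hi (differences t) - lo (differences t))))^-1 *: differences t.

Let ext_differences t i : ext (differences t) i = t (e i) - t (e ord_max).
Proof.
case: (unliftP ord_max i) => [j ->|->]; first by rewrite ext_lift mxE.
by rewrite ext_last subrr.
Qed.

Let differences_continuous : continuous differences.
Proof.
move=> t; apply: (@cvg_row _ _ _ (nbhs t) differences (differences t) (nbhs_filter t)) => j.
have E u : differences u ord0 j = u (e (lift ord_max j)) - u (e ord_max).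
  by rewrite /differences mxE.
have : (fun u : {ptws V -> R} => u (e (lift ord_max j)) - u (e ord_max)) @ nbhs t
    --> t (e (lift ord_max j)) - t (e ord_max).
  by apply: cvgB; exact: (@ptws_eval_continuous V R).
rewrite E; apply: cvg_trans; apply: near_eq_cvg; apply: nearW => u.
exact/esym/E.
Qed.

Let norm2_eq0 y j : norm2 y <= 0 -> y ord0 j = 0.
Proof.
move=> n0; have /eqP : norm2 y = 0 by apply/eqP; rewrite eq_le n0 sqrtr_ge0.
rewrite sqrtr_eq0 => S0; apply/eqP; rewrite -sqrf_eq0 eq_le sqr_ge0 andbT.
apply: le_trans S0; rewrite (bigD1 j)//= lerDl.
by apply: sumr_ge0 => i _; exact: sqr_ge0.
Qed.

Let den_gt0 y : 0 < Num.max (norm2 y) (1 - (hi y - lo y)).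
Proof.
rewrite lt_max; have [//|n0] := ltP 0 (norm2 y); apply/orP; right.
have y0 i : ext y i = 0.
  case: (unliftP ord_max i) => [j ->|->]; last exact: ext_last.
  by rewrite ext_lift norm2_eq0.
by have [i ->] := hi_ex y; have [j ->] := lo_ex y; rewrite !y0 !subr0.
Qed.

Let to_ball_continuous : continuous to_ball.
Proof.
move=> t; have FF := nbhs_filter t.
have dc (g : 'rV[R]_k.+1 -> R) : continuous g ->
    (fun u => g (differences u)) @ nbhs t --> g (differences t).
  move=> gc; exact: (cvg_comp differences g (differences_continuous (x := t)) (gc _)).
have den_cvg : (fun u => Num.max (norm2 (differences u))
      (1 - (hi (differences u) - lo (differences u)))) @ nbhs t -->
    Num.max (norm2 (differences t)) (1 - (hi (differences t) - lo (differences t))).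
  apply: (dc (norm2 \max (fun y => 1 - (hi y - lo y)))).
  apply: max_fun_continuous; first exact: norm2_continuous.
  have subc (f g : 'rV[R]_k.+1 -> R) : continuous f -> continuous g ->
    continuous (fun y => f y - g y) by move=> fc gc y; exact: (cvgB (fc y) (gc y)).
  have c1 : continuous ((fun=> 1) : 'rV[R]_k.+1 -> R) by exact: cst_continuous.
  exact (subc _ _ c1 (subc _ _ hi_continuous lo_continuous)).
have den_inv := cvgV (lt0r_neq0 (den_gt0 (differences t))) den_cvg.
exact: (cvgZ (den_inv FF) (differences_continuous (x := t))).
Qed.

Let from_ball_continuous y : 0 < hi y - lo y -> {for y, continuous from_ball}.
Proof.
move=> osc0.
have FF : Filter (nbhs y) := nbhs_filter y.
apply: (@cvg_pointwise _ _ _ (nbhs y) from_ball (from_ball y) FF) => v.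
rewrite /from_ball; case: ifP => _; last exact: cvg_cst.
have den_inv := cvgV (lt0r_neq0 osc0)
  (cvgB (hi_continuous (x := y)) (lo_continuous (x := y))).
have num := cvgB (ext_continuous (i := idx v) (x := y)) (lo_continuous (x := y)).
exact: (cvgM (num FF) (den_inv FF FF)).
Qed.

Let from_ball_boundary y : 0 < hi y - lo y -> cell_boundary s (from_ball y).
Proof.
move=> osc0; split; first split.
- move=> v; rewrite /from_ball; case: ifP => _; last by rewrite lexx ler01.
  rewrite ler_pdivrMr// mul1r lerD2r hi_ge andbT.
  by rewrite divr_ge0 ?(ltW osc0)// subr_ge0 lo_le.
- by move=> v /negbTE vs; rewrite /from_ball vs.
- have [i yi] := hi_ex y; exists (e i); first exact: e_in.
  by rewrite /from_ball e_in eK -yi divff// gt_eqF.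
- have [i yi] := lo_ex y; exists (e i); first exact: e_in.
  by rewrite /from_ball e_in eK -yi subrr mul0r.
Qed.

Let norm2_sqr y : norm2 y ^+ 2 = \sum_i y ord0 i ^+ 2.
Proof. by rewrite sqr_sqrtr//; apply: sumr_ge0 => i _; exact: sqr_ge0. Qed.

Let to_ball_sqr t : \sum_i to_ball t ord0 i ^+ 2 =
  (norm2 (differences t) / Num.max (norm2 (differences t))
    (1 - (hi (differences t) - lo (differences t)))) ^+ 2.
Proof.
rewrite expr_div_n norm2_sqr mulrC mulr_sumr; apply: eq_bigr => i _.
by rewrite /to_ball mxE exprMn exprVn.
Qed.

Let to_ball_unit_ball t : unit_ball k.+1 (to_ball t).
Proof.
rewrite /unit_ball /= to_ball_sqr expr_le1 ?divr_ge0 ?sqrtr_ge0//; last exact/ltW/den_gt0.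
by rewrite ler_pdivrMr ?den_gt0// mul1r le_max lexx.
Qed.

Let boundary_extrema t : cell_boundary s t ->
  hi (differences t) = 1 - t (e ord_max) /\ lo (differences t) = - t (e ord_max).
Proof.
move=> [[t01 _ [v vs tv]] [w ws tw]]; split; apply/eqP; rewrite eq_le.
- apply/andP; split.
    have [i ->] := hi_ex (differences t); rewrite ext_differences lerD2r.
    by case/andP: (t01 (e i)).
  by have := hi_ge (differences t) (idx v); rewrite ext_differences idxK// tv.
- apply/andP; split.
    by have := lo_le (differences t) (idx w); rewrite ext_differences idxK// tw add0r.
  have [i ->] := lo_ex (differences t); rewrite ext_differences lerDr.
  by case/andP: (t01 (e i)).
Qed.

Let boundary_norm2 t : cell_boundary s t ->
  0 < norm2 (differences t) /\ to_ball t = (norm2 (differences t))^-1 *: differences t.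
Proof.
move=> bt; have [ht lt] := boundary_extrema bt.
have := den_gt0 (differences t).
rewrite /to_ball ht lt opprK subrK subrr.
by rewrite lt_max ltxx orbF => n0; rewrite max_l ?(ltW n0).
Qed.

Let to_ball_sphere t : cell_boundary s t -> sphere k (to_ball t).
Proof.
move=> bt; have [n0 tE] := boundary_norm2 bt.
rewrite /sphere /= tE; under eq_bigr do rewrite mxE exprMn.
by rewrite -mulr_sumr -norm2_sqr -exprMn mulVf ?expr1n// gt_eqF.
Qed.

Let extZ (c : R) y i : ext (c *: y) i = c * ext y i.
Proof.
case: (unliftP ord_max i) => [j ->|->]; first by rewrite !ext_lift mxE.
by rewrite !ext_last mulr0.
Qed.

Let hiZ (c : R) y : 0 <= c -> hi (c *: y) = c * hi y.
Proof.
move=> c0; rewrite /hi (big_morph (fun z => c * z) (fun a b => maxr_pMr a b c0) (mulr0 c)).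
by apply: eq_bigr => i _; exact: extZ.
Qed.

Let loZ (c : R) y : 0 <= c -> lo (c *: y) = c * lo y.
Proof.
move=> c0; rewrite /lo (big_morph (fun z => c * z) (fun a b => minr_pMr a b c0) (mulr0 c)).
by apply: eq_bigr => i _; exact: extZ.
Qed.

Let to_ballK t : cell_boundary s t -> from_ball (to_ball t) = t.
Proof.
move=> bt; have [n0 tE] := boundary_norm2 bt; have [ht lt] := boundary_extrema bt.
have c0 : 0 <= (norm2 (differences t))^-1 by rewrite invr_ge0 ltW.
apply/funext => v; rewrite /from_ball; case: ifPn => [vs|vs]; last first.
  by case: bt => -[_ /(_ v vs) -> _].
rewrite tE extZ hiZ// loZ// ht lt -!mulrBr ext_differences idxK//.
by rewrite !opprK !subrK mulr1 mulrC mulKf// invr_eq0 gt_eqF.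
Qed.

(** The boundary of a simplex is a sphere. Only the retract part of the usual
    homeomorphism is needed: it turns extensions over the ball of maps of the
    sphere into extensions over the simplex of maps of its boundary. *)
Lemma cell_ball_parametrization :
  exists (a : 'rV[R]_k.+1 -> {ptws V -> R}) (b : {ptws V -> R} -> 'rV[R]_k.+1),
    [/\ {in sphere k, continuous a}, a @` sphere k `<=` cell_boundary s,
        continuous b, forall t, unit_ball k.+1 (b t) &
        forall t, cell_boundary s t -> sphere k (b t) /\ a (b t) = t].
Proof.
have osc_sphere y : sphere k y -> 0 < hi y - lo y.
  rewrite /sphere /= => y1; have [j] : exists j, y ord0 j != 0.
    apply: contrapT => /forallNP y0; move: y1; rewrite big1 => [/eqP|i _].
      by rewrite eq_sym oner_eq0.
    by have /negP := y0 i; rewrite negbK => /eqP ->; rewrite expr0n.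
  exact: osc_gt0.
exists from_ball, to_ball; split.
- by move=> y /set_mem /osc_sphere; exact: from_ball_continuous.
- by move=> _ [y /osc_sphere y0 <-]; exact: from_ball_boundary.
- exact: to_ball_continuous.
- exact: to_ball_unit_ball.
- by move=> t bt; split; [exact: to_ball_sphere | exact: to_ballK].
Qed.

End BallParametrization.
End Cell.

(** * Maps on simplicial complexes *)

Section WithinContinuity.
Context {X Y Z : topologicalType}.

Lemma within_continuous_comp_within (A : set X) (B : set Y) (f : X -> Y) (g : Y -> Z) :
  {within A, continuous f} -> f @` A `<=` B -> {within B, continuous g} ->
  {within A, continuous (g \o f)}.
Proof.
move=> /subspace_continuousP fc fAB /subspace_continuousP gc.
apply/subspace_continuousP => x Ax N gN.
have H1 : nbhs (f x) [set w | B w -> N (g w)] := gc _ (fAB _ (imageP f Ax)) _ gN.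
have H2 : nbhs x [set z | A z -> B (f z) -> N (g (f z))] := fc x Ax _ H1.
suff : nbhs x [set z | A z -> N (g (f z))] by [].
by apply: filterS H2 => z H Az; apply: H => //; apply: fAB; exact: imageP.
Qed.

Lemma within_continuous_bigcup (I : Type) (D : set I) (F : I -> set X) (f : X -> Y) :
  finite_set D -> (forall i, D i -> closed (F i)) ->
  (forall i, D i -> {within F i, continuous f}) ->
  {within \bigcup_(i in D) F i, continuous f}.
Proof.
move=> finD clF cF; apply/subspace_continuousP => x _ N fN.
have : nbhs x [set y | forall i, D i -> F i y -> N (f y)].
  apply: (@filter_finite_set _ _ (nbhs x) D (fun i => [set y | F i y -> N (f y)])) => // i Di.
  have [Fx|nFx] := pselect (F i x).
    by have /subspace_continuousP/(_ _ Fx _ fN) := cF _ Di.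
  have : nbhs x (~` F i) by apply: open_nbhs_nbhs; split=> //; apply: closed_openC; exact: clF.
  by apply: filterS => y nFy /nFy.
move=> H; suff : nbhs x [set y | (\bigcup_(i in D) F i) y -> N (f y)] by [].
by apply: filterS H => y H [i Di Fy]; exact: (H i).
Qed.

Lemma within_continuous_eq (A : set X) (f g : X -> Y) :
  (forall x, A x -> f x = g x) -> {within A, continuous f} -> {within A, continuous g}.
Proof.
move=> fg; apply: subspace_eq_continuous => x /set_mem; exact: fg.
Qed.

End WithinContinuity.

Section Skeleton.
Context {R : realType} {V : choiceType} {E : topologicalType}.
Implicit Types (s : {fset V}) (t : {ptws V -> R}) (u : {ptws V -> R} -> E).

(** The set of values of the filling [u'] is controlled by that of the extension [g]
    over the ball, so that the lemma serves both for extensions into a given set and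
    for extensions of small diameter. *)
Lemma cell_extension (k : nat) s u : #|` s| = k.+2 ->
  {within cell_boundary s, continuous u} ->
  exists f : 'rV[R]_k.+1 -> E, [/\ {within sphere k, continuous f},
    f @` sphere k `<=` u @` cell_boundary s &
    forall g, {within unit_ball k.+1, continuous g} ->
      (forall x, sphere k x -> g x = f x) ->
      exists u', [/\ {within cell s, continuous u'},
        forall t, cell_boundary s t -> u' t = u t &
        u' @` cell s `<=` g @` unit_ball k.+1]].
Proof.
move=> cs uc; have [a [b [ac asub bc bball bK]]] := cell_ball_parametrization (R := R) cs.
exists (u \o a); split.
- by apply: within_continuous_comp_within uc => //; exact: continuous_in_subspaceT.
- by move=> _ [x xS <-]; exists (a x) => //; apply: asub; exists x.
- move=> g gc gf; exists (g \o b); split.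
  + apply: within_continuous_comp_within gc; first exact: continuous_subspaceT.
    by move=> _ [t _ <-]; exact: bball.
  + by move=> t /bK [bS abt] /=; rewrite gf//= abt.
  + by move=> _ [t _ <-]; exists (b t).
Qed.

(** The vertex set of the smallest simplex containing the point [t]. *)
Definition carrier t : {fset V} := fset_set [set v | t v != 0].

Lemma mem_carrier s t : cell s t -> forall v, (v \in carrier t) = (t v != 0).
Proof.
move=> [_ ts _] v; rewrite in_fset_set.
  by apply/idP/idP => [/set_mem|]; [|move=> h; apply/mem_set].
apply: (finite_subfset s) => w /= tw; apply: contraNT tw => /ts ->.
by rewrite eqxx.
Qed.

Lemma carrier_sub s t : cell s t -> (carrier t `<=` s)%fset.
Proof.
move=> st; apply/fsubsetP => v; rewrite (mem_carrier st).
by apply: contraNT => vs; have [_ /(_ _ vs) -> _] := st; rewrite eqxx.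
Qed.

Lemma cell_carrier s t : cell s t -> cell (carrier t) t.
Proof.
move=> st; have supp := mem_carrier st; case: st => t01 ts [v vs tv]; split=> //.
  by move=> w; rewrite supp negbK => /eqP.
by exists v => //; rewrite supp tv oner_eq0.
Qed.

Lemma carrier_boundary s t : cell s t -> carrier t != s -> cell_boundary s t.
Proof.
move=> st ns; split=> //.
have /fsubsetPn[v vs] : ~~ (s `<=` carrier t)%fset.
  by apply: contra ns => sub; rewrite eqEfsubset carrier_sub.
by rewrite (mem_carrier st) negbK => /eqP tv; exists v.
Qed.

Definition simplicial_complex (K : set {fset V}) :=
  forall s s', (s' `<=` s)%fset -> K s -> K s'.

Lemma boundary_continuous s u :
  (forall v, v \in s -> {within cell (s `\ v)%fset, continuous u}) ->
  {within cell_boundary s, continuous u}.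
Proof.
move=> uc; have -> : cell_boundary s = \bigcup_(v in [set` s]) cell (R := R) (s `\ v)%fset.
  by apply/seteqP; split=> t; [move=> /cell_boundaryP[v vs vt]; exists v
    | move=> [v vs vt]; apply/cell_boundaryP; exists v].
apply: within_continuous_bigcup; first exact: finite_fset.
  by move=> v _; exact: cell_closed.
by move=> v vs; exact: uc.
Qed.

(** Extension of a map from a subcomplex [K0] to a complex [K] by induction on the
    skeleta. A single function on all of [{ptws V -> R}] represents the maps on the
    simplices, so that their compatibility needs no bookkeeping: the simplex in
    which a point is filled is determined by its carrier. The predicate [P]
    is the constraint imposed on the image of each simplex. *)
Lemma skeleton_extension (K0 K : set {fset V}) (P : {fset V} -> set E -> Prop)
    (n : nat) (u0 : {ptws V -> R} -> E) :
  simplicial_complex K0 -> simplicial_complex K -> K0 `<=` K ->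
  (forall s, K s -> (#|` s| <= n)%N) ->
  (forall s, K0 s -> {within cell s, continuous u0}) ->
  (forall s, K0 s -> s != fset0 -> P s (u0 @` cell s)) ->
  (forall s u, K s -> ~ K0 s -> s != fset0 ->
    {within cell_boundary s, continuous u} ->
    (forall s', (s' `<` s)%fset -> s' != fset0 -> P s' (u @` cell s')) ->
    exists u', [/\ {within cell s, continuous u'},
      forall t, cell_boundary s t -> u' t = u t & P s (u' @` cell s)]) ->
  exists u, [/\ forall s t, K0 s -> cell s t -> u t = u0 t,
    forall s, K s -> {within cell s, continuous u} &
    forall s, K s -> s != fset0 -> P s (u @` cell s)].
Proof.
move=> cK0 cK K0K Kn u0c u0P step.
suff H d : exists u, [/\ forall s t, K0 s -> cell s t -> u t = u0 t,
    forall s, K s -> K0 s \/ (#|` s| <= d)%N -> {within cell s, continuous u} &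
    forall s, K s -> K0 s \/ (#|` s| <= d)%N -> s != fset0 -> P s (u @` cell s)].
  have [u [u_u0 uc uP]] := H n; exists u; split=> // s Ks.
    by apply: uc => //; right; exact: Kn.
  by apply: uP => //; right; exact: Kn.
elim: d => [|d [u [u_u0 uc uP]]].
  exists u0; split=> // s Ks [K0s|]; do ?[exact: u0c | exact: u0P].
    rewrite leqn0 cardfs_eq0 => /eqP ->.
    have -> : cell (R := R) (fset0 : {fset V}) = set0.
      by rewrite -subset0 => t [_ _ [v]]; rewrite inE.
    exact: continuous_subspace0.
  by rewrite leqn0 cardfs_eq0 => ->.
pose new s := [/\ K s, ~ K0 s & #|` s| = d.+1].
have /choice[fill fillP] : forall s, exists u' : {ptws V -> R} -> E, new s ->
    [/\ {within cell s, continuous u'},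
      forall t, cell_boundary s t -> u' t = u t & P s (u' @` cell s)].
  move=> s; have [[Ks nK0s sd]|ns] := pselect (new s); last by exists u.
  have s0 : s != fset0 by rewrite -cardfs_gt0 sd.
  have [|s' s's s'0|u' u'P] := step s u Ks nK0s s0; last by exists u'.
    apply: boundary_continuous => v vs; apply: uc; first exact: cK (fsubD1set _ _) Ks.
    by right; rewrite -ltnS -sd; exact: fproper_ltn_card (fproperD1 vs).
  apply: uP => //; first exact: cK (fproper_sub s's) Ks.
  by right; rewrite -ltnS -sd; exact: fproper_ltn_card.
pose u' t := if pselect (new (carrier t)) then fill (carrier t) t else u t.
have u'_old s t : cell s t -> K0 s \/ (#|` s| <= d)%N -> u' t = u t.
  move=> st sold; rewrite /u'; case: pselect => // newt; exfalso.
  have [_ nK0t td] := newt.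
  case: sold => [K0s|]; first by apply: nK0t; exact: cK0 (carrier_sub st) K0s.
  by apply/negP; rewrite -ltnNge -td; exact: fsubset_leq_card (carrier_sub st).
have u'_new s t : cell s t -> new s -> u' t = fill s t.
  move=> st news; rewrite /u'.
  have [->|ts] := eqVneq (carrier t) s; first by case: pselect.
  have [_ fb _] := fillP s news; rewrite (fb _ (carrier_boundary st ts)).
  case: pselect => // newt; exfalso; have [_ _ td] := newt; have [_ _ sd] := news.
  have : (carrier t `<` s)%fset by rewrite fproperEneq ts (carrier_sub st).
  by move=> /fproper_ltn_card; rewrite td sd ltnn.
have cases s : K s -> K0 s \/ (#|` s| <= d.+1)%N ->
    (K0 s \/ (#|` s| <= d)%N) \/ new s.
  move=> Ks [K0s|sd]; first by left; left.
  have [K0s|nK0s] := pselect (K0 s); first by left; left.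
  move: sd; rewrite leq_eqVlt ltnS => /orP[/eqP sd|]; first by right.
  by left; right.
exists u'; split.
- by move=> s t K0s st; rewrite (u'_old s)//; [exact: u_u0 st | left].
- move=> s Ks /(cases s Ks) [old|news].
    by apply: within_continuous_eq (uc s Ks old) => t st; rewrite (u'_old s).
  have [fc _ _] := fillP s news.
  by apply: within_continuous_eq fc => t st; rewrite (u'_new s).
- move=> s Ks /(cases s Ks) [old|news] s0.
    rewrite (_ : u' @` cell s = u @` cell s); first exact: uP.
    by apply: eq_imagel => t st; exact: u'_old st old.
  have [_ _ fP] := fillP s news.
  rewrite (_ : u' @` cell s = fill s @` cell s)//.
  by apply: eq_imagel => t st; exact: u'_new st news.
Qed.

(** Near [y] only finitely many vertices matter, hence [l] takes its values in a
    finite union of simplices, which are closed; there the pasting lemma applies. *)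
Lemma complex_map_continuous (Y : topologicalType) (D : set Y)
    (l : Y -> {ptws V -> R}) (K : set {fset V}) u :
  simplicial_complex K -> (forall s, K s -> {within cell s, continuous u}) ->
  {within D, continuous l} -> (forall y, D y -> exists2 s, K s & cell s (l y)) ->
  (forall y, D y -> exists2 W, nbhs y W &
    finite_set [set v | exists2 z, (W `&` D) z & l z v != 0]) ->
  {within D, continuous (u \o l)}.
Proof.
move=> cK uc lc lK lf; apply/subspace_continuousP => y Dy N uN.
have [W Wy finW] := lf y Dy.
pose F := fset_set [set v | exists2 z, (W `&` D) z & l z v != 0].
pose B := \bigcup_(s in [set s | (s `<=` F)%fset /\ K s]) cell (R := R) s.
have lB z : W z -> D z -> B (l z).
  move=> Wz Dz; have [s Ks sz] := lK z Dz.
  exists (carrier (l z)); last exact: cell_carrier sz.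
  split; last exact: cK (carrier_sub sz) Ks.
  apply/fsubsetP => v; rewrite (mem_carrier sz) => lzv.
  by rewrite /F in_fset_set//; apply/mem_set; exists z.
have uB : {within B, continuous u}.
  apply: within_continuous_bigcup.
  - apply: (finite_subfset (fpowerset F)) => s [sF _].
    by rewrite /= fpowersetE.
  - by move=> s _; exact: cell_closed.
  - by move=> s [_ Ks]; exact: uc.
have By : B (l y) by apply: lB => //; exact: nbhs_singleton.
move/subspace_continuousP : uB => uB; move/subspace_continuousP : lc => lc.
have H1 : nbhs (l y) [set t | B t -> N (u t)] := uB _ By _ uN.
have H2 : nbhs y [set z | D z -> B (l z) -> N (u (l z))] := lc y Dy _ H1.
suff : nbhs y [set z | D z -> N (u (l z))] by [].
by apply: filterS2 Wy H2 => z Wz H Dz; apply: H => //; exact: lB.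
Qed.

End Skeleton.

(** * Selections of stable set-valued maps *)

Section StableSelection.
Context {R : realType} {X E : topologicalType} {N : nat} {Psi : nat -> X -> set E}.
Hypotheses (hausX : hausdorff_space X) (paraX : paracompact X)
  (dimX : covering_dim_le X N).
Hypothesis Psi_nonempty : forall x, Psi 0%N x !=set0.
Hypothesis Psi_stable : forall k x (K : set E), (k <= N)%N -> compact K ->
  K `<=` Psi k x -> \forall y \near x, K `<=` Psi k y.
Hypothesis Psi_extends : forall k x, (k < N)%N -> forall f : 'rV[R]_k.+1 -> E,
  sphere_map (Psi k x) f -> exists g, ball_extension (Psi k.+1 x) f g.

(** An extension of a constant map of the sphere takes the constant as a value. *)
Lemma stable_mono k x : (k < N)%N -> Psi k x `<=` Psi k.+1 x.
Proof.
move=> kN e Pe.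
have [|g [_ gB gf]] := @Psi_extends k x kN (fun=> e).
  by split; [apply: continuous_subspaceT; exact: cst_continuous | move=> _ [_ _ <-]].
pose d : 'rV[R]_k.+1 := \row_j (j == ord0)%:R.
have dS : \sum_i d ord0 i ^+ 2 = 1.
  rewrite (bigD1 ord0)//= mxE eqxx expr1n big1 ?addr0// => i /negbTE i0.
  by rewrite mxE i0 expr0n.
by rewrite -(gf d dS); apply: gB; exists d => //; rewrite /unit_ball /= dS.
Qed.

Lemma stable_mono_le k x : (k <= N)%N -> Psi k x `<=` Psi N x.
Proof.
move=> /subnKC; move: (N - k)%N => m; elim: m k => [|m ih] k; first by rewrite addn0 => ->.
rewrite addnS -addSn => kmN; apply: subset_trans (ih k.+1 kmN).
by apply: stable_mono; rewrite -kmN leq_addr.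
Qed.

Implicit Types (v w : nat * X) (s : {fset nat * X}) (V : nat * X -> set X)
  (u : {ptws (nat * X) -> R} -> E).

(** A vertex [(j, p)] stands for the member with index [p] of the cover of stage
    [j]. In the simplices considered all vertices come from different stages, which
    bounds their dimension. *)
Definition rainbow s := forall v w, v \in s -> w \in s -> v.1 = w.1 -> v = w.

Definition stage_complex i V s := [/\ forall v, v \in s -> (v.1 < i)%N, rainbow s &
  exists x, forall v, v \in s -> closure (V v) x].

Definition stage_cover i V := forall j, (j < i)%N ->
  [/\ forall p, open (V (j, p)), forall x, exists p, V (j, p) x &
      locally_finite_family (fun p => V (j, p))].

Definition stage_map i V u :=
  (forall s, stage_complex i V s -> {within cell s, continuous u}) /\
  (forall s x, stage_complex i V s -> (forall v, v \in s -> closure (V v) x) ->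
    u @` cell s `<=` Psi #|` s|.-1 x).

Lemma rainbow_sub s s' : (s' `<=` s)%fset -> rainbow s -> rainbow s'.
Proof. by move=> /fsubsetP ss' rs v w /ss' vs /ss' ws; exact: rs. Qed.

Lemma rainbow_card i s : (forall v, v \in s -> (v.1 < i)%N) -> rainbow s ->
  (#|` s| <= i)%N.
Proof.
move=> si rs.
have <- : #|` [fset v.1 | v in s]%fset| = #|` s| by apply: card_in_imfset => v w; exact: rs.
have -> : i = #|` [fset j in iota 0 i]%fset|.
  by rewrite card_fseq undup_id ?iota_uniq// size_iota.
apply/fsubset_leq_card/fsubsetP => _ /imfsetP[v /= vs ->].
by rewrite !inE mem_iota /= add0n si.
Qed.

Lemma stage_complex_simplicial i V : simplicial_complex (stage_complex i V).
Proof.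
move=> s s' ss' [si rs [x sx]]; split.
- by move=> v /(fsubsetP ss'); exact: si.
- exact: rainbow_sub rs.
- by exists x => v /(fsubsetP ss'); exact: sx.
Qed.

Lemma stage_star_finite i V p : stage_cover i V ->
  finite_set [set v | (v.1 < i)%N /\ closure (V v) p].
Proof.
move=> cV.
apply: (@sub_finite_set _ _ (\bigcup_(j in `I_i)
    ((pair j) @` [set q | closure (V (j, q)) p]))).
  by move=> [j q] /= [ji clq]; exists j => //; exists q.
apply: bigcup_finite; first exact: finite_II.
move=> j /= ji; apply: finite_image; have [_ _ lf] := cV j ji.
have [W Wp finW] := locally_finite_closure lf p.
by apply: sub_finite_set finW => q clq; exists p; split=> //; exact: nbhs_singleton.
Qed.

(** Moving away slightly from [p] creates no new vertices of earlier stages, so the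
    simplices filled at [p] are all that is needed near [p]. *)
Lemma stage_star_near i V p : stage_cover i V ->
  \forall x \near p, forall v, (v.1 < i)%N -> closure (V v) x -> closure (V v) p.
Proof.
move=> cV.
have : nbhs p [set x | forall j, `I_i j ->
    forall q, closure (V (j, q)) x -> closure (V (j, q)) p].
  apply: (@filter_finite_set _ _ (nbhs p) `I_i
    (fun j => [set x | forall q, closure (V (j, q)) x -> closure (V (j, q)) p])).
    exact: finite_II.
  move=> j /= ji; have [_ _ lf] := cV j ji.
  pose D := [set q | ~ closure (V (j, q)) p].
  have nclp : ~ closure (\bigcup_(q in D) closure (V (j, q))) p.
    move=> clp; have [|q Dq] := closure_bigcup_locally_finite _ clp.
      move=> x; have [A Ax finA] := locally_finite_closure lf x; exists A => //.
      by apply: sub_finite_set finA => q [].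
    by rewrite -(closure_id _).1//; exact: closed_closure.
  have : nbhs p (~` closure (\bigcup_(q in D) closure (V (j, q)))).
    by apply: open_nbhs_nbhs; split=> //; apply: closed_openC; exact: closed_closure.
  apply: filterS => x nx q clx; apply: contrapT => nclq; apply: nx.
  by apply: subset_closure; exists q.
by apply: filterS => x H [j q] /= ji; exact: H.
Qed.

(** One stage of the construction: every point [p] becomes a new vertex [(i, p)],
    and cones with this apex are filled over the simplices of the previous stages
    around [p], inside the sets [Psi _ p]. By compactness these fillings lie in
    [Psi _ x] for all [x] near [p], and the new cover consists of sets so small. *)
Lemma stage_step i V u : (i <= N)%N -> stage_cover i V -> stage_map i V u ->
  exists V' u', stage_cover i.+1 V' /\ stage_map i.+1 V' u'.
Proof.
move=> iN cV [uc uPsi].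
pose F p := fset_set [set v | (v.1 < i)%N /\ closure (V v) p].
have memF p v : v \in F p <-> (v.1 < i)%N /\ closure (V v) p.
  by rewrite in_fset_set; [split=> [/set_mem|/mem_set] | exact: stage_star_finite].
pose C p := ((i, p) |` F p)%fset.
pose K0 := stage_complex i V.
pose K := K0 `|` [set s | rainbow s /\ exists p, (s `<=` C p)%fset].
have C_lt p v : v \in C p -> (v.1 < i.+1)%N.
  by rewrite !inE => /orP[/eqP -> //|/memF [/ltnW]].
have C_i p q : (i, q) \in C p -> q = p.
  by rewrite !inE => /orP[/eqP[] //|/memF [/=]]; rewrite ltnn.
have K0F p s : rainbow s -> (s `<=` C p)%fset -> (i, p) \notin s ->
    K0 s /\ forall v, v \in s -> closure (V v) p.
  move=> rs sC ips.
  have sF v : v \in s -> v \in F p.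
    move=> vs; have := fsubsetP sC _ vs; rewrite !inE => /orP[/eqP vip|//].
    by rewrite -vip vs in ips.
  have clp v : v \in s -> closure (V v) p by move=> /sF /memF[].
  by split=> //; split=> // [v /sF /memF[] //|]; exists p.
have cK : simplicial_complex K.
  move=> s s' ss' [K0s|[rs [p sC]]].
    by left; exact: (@stage_complex_simplicial i V s).
  by right; split; [exact: rainbow_sub rs | exists p; exact: fsubset_trans sC].
have Kcard s : K s -> (#|` s| <= i.+1)%N.
  move=> [[si rs _]|[rs [p sC]]]; first by apply/ltnW; exact: rainbow_card.
  by apply: rainbow_card rs => v /(fsubsetP sC); exact: C_lt.
(* [rel s x] says that the image of [s] has to lie in [Psi _ x]: an old simplex
   serves all the points around which it lies, a new one only its apex. *)
pose rel s x := (K0 s /\ forall v, v \in s -> closure (V v) x) \/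
  ((i, x) \in s /\ (s `<=` C x)%fset).
pose P s (A : set E) := forall x, rel s x -> A `<=` Psi #|` s|.-1 x.
have K0_i s x : K0 s -> (i, x) \notin s.
  by move=> [si _ _]; apply/negP => /si /=; rewrite ltnn.
have relC p s : rainbow s -> (s `<=` C p)%fset -> rel s p.
  move=> rs sC; have [ips|ips] := boolP ((i, p) \in s); first by right.
  by left; exact: K0F.
have [|s K0s s0 x|s w Ks nK0s s0 wc wP|u1 [_ u1c u1P]] :=
  @skeleton_extension R _ E K0 K P i.+1 u (@stage_complex_simplicial i V) cK
    (@subsetUl _ _ _) Kcard.
- exact: uc.
- by move=> [[_ clx]|[ixs _]]; [exact: uPsi | have := K0_i s x K0s; rewrite ixs].
- have [rs [p sC]] : [set s | rainbow s /\ exists p, (s `<=` C p)%fset] s by case: Ks.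
  have ips : (i, p) \in s.
    by apply: contrapT => /negP /(K0F p s rs sC) [].
  have relP x : rel s x -> x = p.
    by move=> [[]//|[/(fsubsetP sC) /C_i]].
  case sk : #|` s| => [|[|k]].
  + by move: s0; rewrite -cardfs_gt0 sk.
  + have [e Pe] := Psi_nonempty p.
    exists (fun=> e); split.
    * by apply: continuous_subspaceT; exact: cst_continuous.
    * move/eqP/cardfs1P : sk => [v ->] t [[_ _ [a]]].
      rewrite inE => /eqP -> tv [b]; rewrite inE => /eqP ->.
      by rewrite tv => /eqP; rewrite oner_eq0.
    * by move=> x /relP ->; rewrite sk => _ [_ _ <-].
  + have kN : (k < N)%N by have := Kcard s Ks; rewrite sk ltnS => /leq_trans; exact.
    have [f [fc fw fill]] := cell_extension sk wc.
    have [|g [gc gB gf]] := @Psi_extends k p kN f.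
      split=> // y /fw [t /cell_boundaryP[v vs vt] <-].
      have cardv : #|` (s `\ v)%fset| = k.+1.
        by have := finmap.cardfsD1 v s; rewrite vs sk add1n => -[].
      have := wP (s `\ v)%fset (fproperD1 vs).
      rewrite -cardfs_gt0 /P cardv => /(_ isT p); apply; last by exists t.
      apply: relC; first exact: rainbow_sub (fsubD1set _ _) rs.
      exact: fsubset_trans (fsubD1set _ _) sC.
    have [u' [u'c u'w u'g]] := fill g gc gf.
    exists u'; split=> // x /relP ->; rewrite sk /=.
    exact: subset_trans gB.
pose W p := [set x | (forall v, (v.1 < i)%N -> closure (V v) x -> closure (V v) p) /\
  forall s, [set` fpowerset (C p)] s -> rainbow s -> u1 @` cell s `<=` Psi #|` s|.-1 x]°.
have Wp p : W p p.
  have : nbhs p [set x | forall s, [set` fpowerset (C p)] s ->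
      rainbow s -> u1 @` cell s `<=` Psi #|` s|.-1 x].
    apply: (@filter_finite_set _ _ (nbhs p) [set` fpowerset (C p)]
      (fun s => [set x | rainbow s -> u1 @` cell s `<=` Psi #|` s|.-1 x])).
      exact: finite_fset.
    move=> s /=; rewrite fpowersetE => sC.
    have [rs|nrs] := pselect (rainbow s); last by apply: nearW => x /nrs.
    have Ks : K s by right; split=> //; exists p.
    have [s0|s0] := eqVneq s fset0.
      by apply: nearW => x _ e [t [_ _ [v vs _]] _]; rewrite s0 inE in vs.
    have : \forall x \near p, u1 @` cell s `<=` Psi #|` s|.-1 x.
      apply: Psi_stable.
      - by have := Kcard s Ks; case: #|` s| => //= n; rewrite ltnS => /leq_trans; exact.
      - by apply: continuous_compact; [exact: u1c | exact: cell_compact].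
      - by apply: u1P => //; exact: relC.
    by apply: filterS => x H _.
  by move=> H; apply: filterS2 (stage_star_near p cV) H => x.
have oW p : open (W p) by exact: open_interior.
have covW x : exists p, W p x by exists x.
have [V1 [oV1 covV1 V1W lfV1]] := paracompact_indexed_refinement paraX hausX oW covW.
pose V' v := if v.1 == i then V1 v.2 else V v.
have V'_lt v : (v.1 < i)%N -> V' v = V v.
  by rewrite /V'; case: eqP => // ->; rewrite ltnn.
have V'_i p : V' (i, p) = V1 p by rewrite /V' eqxx.
exists V', u1; split.
  move=> j; rewrite ltnS leq_eqVlt => /orP[/eqP ->|ji].
    have V'E : (fun p => V' (i, p)) = V1 by apply/funext => p; exact: V'_i.
    split=> [p|x|]; rewrite ?V'E ?V'_i//.
    by have [p V1p] := covV1 x; exists p; rewrite V'_i.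
  have V'E : (fun p => V' (j, p)) = (fun p => V (j, p)).
    by apply/funext => p; exact: V'_lt.
  have [oV covV lfV] := cV j ji.
  split=> [p|x|]; rewrite ?V'E ?V'_lt//.
  by have [p Vp] := covV x; exists p; rewrite V'_lt.
(* A simplex of the new complex is either old, or has an apex [(i, p)]; then its
   other vertices lie around [x], which is near [p], and hence around [p]. *)
have split_complex s x : (forall v, v \in s -> (v.1 < i.+1)%N) -> rainbow s ->
    (forall v, v \in s -> closure (V' v) x) ->
    (K0 s /\ forall v, v \in s -> closure (V v) x) \/
    exists p, [/\ (i, p) \in s, (s `<=` C p)%fset & W p x].
  move=> si rs clx.
  have [[p ips]|nip] := pselect (exists p, (i, p) \in s).
    have Wpx : W p x by apply: V1W; rewrite -V'_i; exact: clx.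
    right; exists p; split=> //; apply/fsubsetP => v vs; rewrite !inE.
    have [//|vip] := eqVneq v (i, p); apply/memF.
    have vi : (v.1 < i)%N.
      have := si v vs; rewrite ltnS leq_eqVlt => /orP[/eqP vi|//].
      by move: vip; rewrite (rs _ _ vs ips vi) eqxx.
    have [star _] := interior_subset Wpx.
    by split=> //; apply: star => //; rewrite -V'_lt//; exact: clx.
  left; have vi v : v \in s -> (v.1 < i)%N.
    move=> vs; have := si v vs; rewrite ltnS leq_eqVlt => /orP[/eqP vi|//].
    by exfalso; apply: nip; exists v.2; rewrite -vi -surjective_pairing.
  have clV v : v \in s -> closure (V v) x.
    by move=> vs; rewrite -V'_lt ?vi//; exact: clx.
  by split=> //; split=> //; exists x.
split=> [s [si rs [x clx]]|s x [si rs _] clx].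
  apply: u1c; have [[K0s _]|[p [_ sC _]]] := split_complex s x si rs clx.
    by left.
  by right; split=> //; exists p.
have [s0|s0] := eqVneq s fset0.
  by move=> e [t [_ _ [v vs _]] _]; rewrite s0 inE in vs.
have [[K0s clV]|[p [_ sC /interior_subset [_ Wx]]]] := split_complex s x si rs clx.
  by apply: u1P => //; [left | left].
by apply: Wx => //=; rewrite fpowersetE.
Qed.

Lemma stages i : (exists x : X, True) -> (i <= N.+1)%N ->
  exists V u, stage_cover i V /\ stage_map i V u.
Proof.
move=> [x0 _]; elim: i => [_|i ih iN].
  have [e _] := Psi_nonempty x0; exists (fun=> setT), (fun=> e); split=> //.
  have K0 s : stage_complex 0 (fun=> setT) s -> s = fset0.
    by move=> [s0 _ _]; apply/eqP; rewrite -fsubset0; apply/fsubsetP => v /s0.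
  split=> [s _|s x /K0 -> _].
    by apply: continuous_subspaceT; exact: cst_continuous.
  by move=> y [t [_ _ [v]]]; rewrite inE.
have [V [u [cV mu]]] := ih (ltnW iN).
exact: stage_step iN cV mu.
Qed.

(** After [N + 1] stages the map [u] sends a simplex with vertices of different
    stages into [Psi N x] as soon as [x] lies in the corresponding members of the
    covers. A refinement of the covers by [N + 1] disjoint families, one for each
    stage, associates such a simplex with each point. *)
Lemma stable_selection :
  exists2 f : X -> E, continuous f & forall x, Psi N x (f x).
Proof.
have [exX|nX] := pselect (exists x : X, True); last first.
  have empty (x : X) : False by apply: nX; exists x.
  by exists (fun x => False_rect E (empty x)) => x; case: (empty x).
have [V [u [cV [uc uPsi]]]] := stages exX (leqnn N.+1).
pose J : choiceType := {ffun 'I_N.+1 -> X}.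
pose W (q : J) := \bigcap_(c in [set: 'I_N.+1]) V (nat_of_ord c, q c).
have oW q : open (W q).
  rewrite openE => x Wx.
  have : nbhs x [set y | forall c : 'I_N.+1, V (nat_of_ord c, q c) y].
    apply: filter_forall => c; have [oV _ _] := cV _ (ltn_ord c).
    by apply: open_nbhs_nbhs; split; [exact: oV | exact: Wx].
  by apply: filterS => y Wy c _; exact: Wy.
have covW x : exists q, W q x.
  have /choice[q qP] : forall c : 'I_N.+1, exists p, V (nat_of_ord c, p) x.
    by move=> c; have [_ + _] := cV _ (ltn_ord c); apply.
  by exists [ffun c => q c] => c _; rewrite ffunE.
have [G [oG GW disjG covG]] :=
  paracompact_coloured_refinement R hausX paraX dimX oW covW.
pose O v := \bigcup_(q in [set q : J | q (inord v.1) = v.2]) G v.1 q.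
have oO v : open (O v) by apply: bigcup_open => q _; exact: oG.
have O_inj c p p' x : O (c, p) x -> O (c, p') x -> p = p'.
  by move=> [q /= <- Gq] [q' /= <- Gq']; rewrite (disjG _ _ _ _ Gq Gq').
have OV v : (v.1 <= N)%N -> O v `<=` V v.
  case: v => c p /= cN x [q /= qp /GW Wq].
  by have := Wq (inord c) Logic.I; rewrite inordK// qp.
pose U (c : 'I_N.+1) := \bigcup_q G c q.
have oU c : open (U c) by apply: bigcup_open => q _; exact: oG.
have covU x : exists c, U c x.
  have [c cN [q Gq]] := covG x; exists (inord c), q => //.
  by rewrite inordK.
have [h [hc h01 hU h1]] := paracompact_bump_functions paraX hausX R oU covU.
pose l x : {ptws (nat * X) -> R} := fun v =>
  if pselect ((v.1 <= N)%N /\ O v x) then h (inord v.1) x else 0.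
have lO x v : l x v != 0 -> (v.1 <= N)%N /\ O v x.
  by rewrite /l; case: pselect => // nO; rewrite eqxx.
have lc : continuous l.
  move=> x; apply: (@cvg_pointwise _ _ _ (nbhs x) l (l x) (nbhs_filter x)) => v.
  have near0 : (\forall y \near x, l y v = 0) -> l y v @[y --> x] --> l x v.
    move=> l0; rewrite (nbhs_singleton l0).
    apply: cvg_trans (@cvg_cst R 0 _ (nbhs x) _); apply: near_eq_cvg.
    by apply: filterS l0 => y ->.
  have [vN|vN] := leqP v.1 N; last first.
    apply: near0; apply: nearW => y.
    by rewrite /l; case: pselect => // -[]; rewrite leqNgt vN.
  have [Ovx|nOvx] := pselect (O v x).
    have lE y : O v y -> l y v = h (inord v.1) y.
      by move=> Ovy; rewrite /l; case: pselect => // -[].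
    rewrite lE//; apply: cvg_trans (hc (inord v.1) x); apply: near_eq_cvg.
    have : nbhs x (O v) by apply: open_nbhs_nbhs.
    by apply: filterS => y /lE ->.
  have l0 y : ~ O v y -> l y v = 0 by move=> nO; rewrite /l; case: pselect => // -[].
  have := h01 (inord v.1) x; rewrite le_eqVlt => /andP[/orP[/eqP h0|hx] _].
    rewrite l0//.
    (* where [h] vanishes, [l] is squeezed between 0 and [h] *)
    apply: (@squeeze_cvgr _ _ _ _ (fun=> 0) (h (inord v.1))).
    - apply: nearW => y; rewrite /l; case: pselect => ?; have /andP[h0y _] := h01 (inord v.1) y.
        by rewrite h0y lexx.
      by rewrite lexx.
    - exact: cvg_cst.
    - rewrite [X in _ --> X]h0; exact: hc.
  have [q _ Gq] := hU _ _ hx; rewrite inordK// in Gq.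
  apply: near0.
  have : nbhs x (G v.1 q) by apply: open_nbhs_nbhs.
  apply: filterS => y Gqy; rewrite l0// => -[q' /= q'v Gq'].
  apply: nOvx; exists q' => //=.
  by rewrite (disjG _ _ _ _ Gq' Gqy).
have lf (x : X) : exists2 A, nbhs x A &
    finite_set [set v | exists2 z, (A `&` [set: X]) z & l z v != 0].
  have /choice[A AP] : forall c : 'I_N.+1, exists A : set X, nbhs x A /\
      finite_set [set p | V (nat_of_ord c, p) `&` A !=set0].
    by move=> c; have [_ _ /(_ x)[A ? ?]] := cV _ (ltn_ord c); exists A.
  exists [set z | forall c, A c z].
    by apply: filter_forall => c; case: (AP c).
  apply: (@sub_finite_set _ _ (\bigcup_(c in [set: 'I_N.+1])
    (pair (nat_of_ord c) @` [set p | V (nat_of_ord c, p) `&` A c !=set0]))).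
    move=> [c p] [z [Az _] /lO [/= cN Oz]].
    exists (inord c) => //; exists p; rewrite inordK//.
    by exists z; split=> //; apply: OV.
  by apply: bigcup_finite => // c _; apply: finite_image; case: (AP c).
have lK x : exists2 s, stage_complex N.+1 V s & cell s (l x).
  pose S := [set v | l x v != 0].
  have finS : finite_set S.
    have [A Ax finA] := lf x; apply: sub_finite_set finA => v lv.
    by exists x => //; split=> //; exact: nbhs_singleton.
  have memS v : (v \in fset_set S) <-> l x v != 0.
    by rewrite in_fset_set//; split=> [/set_mem|/mem_set].
  exists (fset_set S); split.
  - by move=> v /memS /lO [].
  - move=> [c p] [c' p'] /memS /lO [_ /= Ov] /memS /lO [_ Ov'] /= cc'.
    by rewrite -cc' in Ov' *; rewrite (O_inj _ _ _ _ Ov Ov').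
  - by exists x => v /memS /lO [vN /(OV _ vN)]; exact: subset_closure.
  - by move=> v; rewrite /l; case: pselect => ?; [exact: h01 | rewrite lexx ler01].
  - by move=> v /negP vS; apply/eqP; apply: contrapT => /negP lv; apply: vS; apply/memS.
  - have [c hx1] := h1 x; have [q _ Gq] : U c x by apply: hU; rewrite hx1.
    have lx1 : l x (nat_of_ord c, q c) = 1.
      rewrite /l inord_val; case: pselect => // -[]; split; first exact: (ltn_ord c).
      by exists q => //=; rewrite inord_val.
    by exists (nat_of_ord c, q c) => //; apply/memS; rewrite lx1 oner_eq0.
exists (u \o l).
  apply/continuous_subspace_setT.
  apply: (complex_map_continuous (@stage_complex_simplicial N.+1 V) uc) => [|y _|y _].
  - exact/continuous_subspaceT.
  - exact: lK.
  - exact: lf.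
move=> x; have [s Ks sx] := lK x.
have Kt : stage_complex N.+1 V (carrier (l x)).
  exact: stage_complex_simplicial (carrier_sub sx) Ks.
have clt v : v \in carrier (l x) -> closure (V v) x.
  rewrite (mem_carrier sx) => /lO [vN /(OV _ vN)]; exact: subset_closure.
apply: (@stable_mono_le #|` carrier (l x)|.-1).
  case: Kt => tN rt _; have := rainbow_card tN rt.
  by case: #|` _| => //= n; rewrite ltnS.
by apply: (uPsi _ _ Kt clt); exists (l x) => //; exact: cell_carrier sx.
Qed.

End StableSelection.

(** * Kuhn's triangulation of the cube *)

Section KuhnTriangulation.
Context {R : realType} {d L : nat}.
Hypothesis L_gt0 : (0 < L)%N.
Implicit Types (x y : 'rV[R]_d) (v w : {ffun 'I_d -> 'I_(L.*2.+1)}).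

Definition cube : set 'rV[R]_d := [set x | forall i, `|x ord0 i| <= 1].

(* The grid on the cube [-1, 1]^d is rescaled to the integer grid on [0, 2L]^d; the
   additional coordinate [None] of the displacement from [x] to [v] is zero. *)
Let displ v x (o : option 'I_d) : R :=
  if o is Some i then (v i)%:R - L%:R * (x ord0 i + 1) else 0.

Let kuhn v x : R :=
  \prod_(ij : option 'I_d * option 'I_d)
    Num.max 0 (displ v x ij.2 + 1 - displ v x ij.1).

Let kuhn_ge0 v x : 0 <= kuhn v x.
Proof. by apply: prodr_ge0 => ij _; rewrite le_max lexx. Qed.

Let kuhn_gt0P v x : 0 < kuhn v x <-> forall i j, displ v x i < displ v x j + 1.
Proof.
split=> [v0 i j|H].
  rewrite ltNge; apply/negP => ji; move: v0; rewrite /kuhn (bigD1 (i, j))//=.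
  by rewrite max_l ?mul0r ?ltxx// subr_le0.
by apply: prodr_gt0 => ij _; rewrite lt_max subr_gt0 H orbT.
Qed.

Let kuhn_near v x i : 0 < kuhn v x ->
  L%:R * (x ord0 i + 1) - 1 < (v i)%:R < L%:R * (x ord0 i + 1) + 1.
Proof.
move=> /kuhn_gt0P H; have := H (Some i) None; have := H None (Some i).
rewrite /= => h1 h2; apply/andP; split; lra.
Qed.

Let displ_continuous v o : continuous (displ v ^~ o).
Proof.
case: o => [i|]; last exact: cst_continuous.
move=> x; have FF := nbhs_filter x.
have H := @cvgD _ _ _ _ FF _ _ _ _ (@coord_continuous R 1 d ord0 i x) (@cvg_cst R 1 _ _ FF).
exact: (@cvgB _ _ _ _ FF _ _ _ _ (@cvg_cst R (v i)%:R _ _ FF)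
  (@cvgM _ _ _ FF _ _ _ _ (@cvg_cst R L%:R _ _ FF) H)).
Qed.

Let kuhn_continuous v : continuous (kuhn v).
Proof.
move=> x; apply: cvg_big => [||ij _]; [exact: mul_continuous | exact: nbhs_filter |].
have FF := nbhs_filter x.
have c0 : continuous ((fun=> 0) : 'rV[R]_d -> R) by exact: cst_continuous.
have c1 : continuous (fun x => displ v x ij.2 + 1 - displ v x ij.1).
  move=> y; have FFy := nbhs_filter y.
  exact: (@cvgB _ _ _ _ FFy _ _ _ _ (@cvgD _ _ _ _ FFy _ _ _ _
    (@displ_continuous v ij.2 y) (@cvg_cst R 1 _ _ FFy)) (@displ_continuous v ij.1 y)).
exact: (max_fun_continuous c0 c1).
Qed.

Let kuhn_cover x : cube x -> exists v, 0 < kuhn v x.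
Proof.
move=> x1; have z0 i : 0 <= L%:R * (x ord0 i + 1).
  by rewrite mulr_ge0//; have := x1 i; rewrite ler_norml => /andP[? _]; lra.
have z2 i : (Num.truncn (L%:R * (x ord0 i + 1)) < L.*2.+1)%N.
  have zt : (Num.truncn (L%:R * (x ord0 i + 1)))%:R <= L%:R * (x ord0 i + 1).
    by rewrite truncn_le.
  rewrite ltnS -(ler_nat R); apply: le_trans zt _.
  rewrite -muln2 natrM ler_pM2l ?ltr0n//.
  by have := x1 i; rewrite ler_norml => /andP[_ ?]; lra.
exists [ffun i => Ordinal (z2 i)]; apply/kuhn_gt0P.
have dl o : -1 < displ [ffun i => Ordinal (z2 i)] x o <= 0.
  case: o => [i|] /=; last by rewrite lexx andbT; lra.
  rewrite ffunE /=; have /andP[tl tg] := truncn_itv (z0 i).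
  by apply/andP; split; [rewrite -natr1 in tg; lra | lra].
by move=> i j; have /andP[? ?] := dl i; have /andP[? ?] := dl j; lra.
Qed.

(** The vertices with [0 < kuhn v x] form a chain for the coordinatewise order, in
    which each of them is determined by the number of coordinates where it exceeds
    [x]. *)
Let above v x : {set 'I_d} := [set i | L%:R * (x ord0 i + 1) < (v i)%:R].

Let kuhn_comparable v w x i : 0 < kuhn v x -> 0 < kuhn w x -> (v i < w i)%N ->
  (#|above v x| < #|above w x|)%N.
Proof.
move=> v0 w0 vwi; apply: proper_card; apply/properP; split.
  apply/fintype.subsetP => j; rewrite !inE => /lt_le_trans; apply.
  rewrite ler_nat leqNgt; apply/negP => wvj.
  move/kuhn_gt0P : w0 => /(_ (Some i) (Some j)) /=.
  move/kuhn_gt0P : v0 => /(_ (Some j) (Some i)) /=.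
  move: vwi wvj; rewrite -!(ler_nat R) -!natr1 => h1 h2 h3 h4; lra.
exists i; rewrite !inE.
  have /andP[h _] := kuhn_near i v0; move: vwi; rewrite -(ler_nat R) -natr1; lra.
have /andP[_ h] := kuhn_near i w0.
rewrite -leNgt; move: vwi; rewrite -(ler_nat R) -natr1; lra.
Qed.

Let kuhn_order x (s : {fset {ffun 'I_d -> 'I_(L.*2.+1)}}) :
  (forall v, v \in s -> 0 < kuhn v x) -> (#|` s| <= d.+1)%N.
Proof.
move=> s0.
have <- : #|` [fset #|above v x| | v in s]%fset| = #|` s|.
  apply: card_in_imfset => v w vs ws vw; apply/ffunP => i; apply/val_inj.
  case: (ltngtP (v i) (w i)) => // [h|h].
    by have := kuhn_comparable (s0 _ vs) (s0 _ ws) h; rewrite vw ltnn.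
  by have := kuhn_comparable (s0 _ ws) (s0 _ vs) h; rewrite vw ltnn.
have -> : d.+1 = #|` [fset j in iota 0 d.+1]%fset|.
  by rewrite card_fseq undup_id ?iota_uniq// size_iota.
apply/fsubset_leq_card/fsubsetP => _ /imfsetP[v _ ->].
have mem_lt n j : (j \in [fset j in iota 0 n]%fset) = (j < n)%N.
  by rewrite !inE mem_iota.
rewrite mem_lt ltnS.
by have := max_card (mem (above v x)); rewrite card_ord.
Qed.

(** Functions supported in the stars of the vertices of a fine triangulation. After
    the rescaling, all factors of [kuhn v x] are positive exactly when some point of
    the half-open segment from [x] to [x + (1, ..., 1)] has [v] as its vector of
    integer parts; the [v] obtained in this way span the simplex of Kuhn's
    triangulation that contains [x]. *)
Lemma kuhn_functions : exists l : {ffun 'I_d -> 'I_(L.*2.+1)} -> 'rV[R]_d -> R,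
  [/\ forall v x, cube x -> {for x, continuous (l v)},
    forall v x, 0 <= l v x <= 1, forall x, cube x -> exists v, l v x = 1,
    forall x (s : {fset {ffun 'I_d -> 'I_(L.*2.+1)}}),
      (forall v, v \in s -> l v x != 0) -> (#|` s| <= d.+1)%N &
    forall v x y i, l v x != 0 -> l v y != 0 -> `|x ord0 i - y ord0 i| < 2 / L%:R].
Proof.
pose M x := \big[Num.max/0]_v kuhn v x.
have M_ge v x : kuhn v x <= M x by exact: le_bigmax.
have M_ge0 x : 0 <= M x.
  by rewrite /M; elim/big_ind : _ => // a b a0 b0; rewrite le_max a0.
have M_gt0 x : cube x -> 0 < M x.
  by move=> /kuhn_cover[v v0]; exact: lt_le_trans v0 (M_ge v x).
have M_cont : continuous M.
  move=> x; apply: cvg_big => [||v _]; [exact: max_continuous | exact: nbhs_filter |].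
  exact: kuhn_continuous.
have nz v x : kuhn v x / M x != 0 -> 0 < kuhn v x.
  by move=> nz0; rewrite lt0r kuhn_ge0 andbT; apply: contraNN nz0 => /eqP ->; rewrite mul0r.
exists (fun v x => kuhn v x / M x); split.
- move=> v x /M_gt0 Mx; have FF := nbhs_filter x.
  exact: (@cvgM _ _ _ FF _ _ _ _ (@kuhn_continuous v x)
    (@cvgV _ _ _ FF _ _ (lt0r_neq0 Mx) (@M_cont x))).
- move=> v x; rewrite divr_ge0//=.
  have [M0|M0] := eqVneq (M x) 0; first by rewrite M0 invr0 mulr0 ler01.
  by rewrite ler_pdivrMr ?mul1r// lt_neqAle eq_sym M0 M_ge0.
- move=> x x1; have Mx := M_gt0 x x1.
  have [Mx0|[v Mv]] : M x = 0 \/ exists v, M x = kuhn v x.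
    rewrite /M; elim/big_ind : _ => [|a b|v _]; [by left| | by right; exists v].
    by rewrite maxEle; case: ifP.
  + by rewrite Mx0 ltxx in Mx.
  + by exists v; rewrite -Mv divff// gt_eqF.
- by move=> x s sl; apply: (@kuhn_order x) => v /sl /nz.
- move=> v x y i /nz /(kuhn_near i) /andP[h1 h2] /nz /(kuhn_near i) /andP[h3 h4].
  have L0 : 0 < L%:R :> R by rewrite ltr0n.
  rewrite ltr_pdivlMr// -[X in _ * X](gtr0_norm L0) -normrM ltr_norml mulrBl.
  by apply/andP; split; rewrite !(mulrC _ L%:R); lra.
Qed.

End KuhnTriangulation.

(** * Approximation of maps into uniformly equi-LC families *)

Lemma compact_uniform_continuity (R : realType) (X : pseudoMetricType R)
    (E : normedModType R) (K : set X) (g : X -> E) :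
  compact K -> {within K, continuous g} -> forall eps : R, 0 < eps ->
  exists2 w : R, 0 < w & forall x y, K x -> K y -> ball x w y -> `|g x - g y| < eps.
Proof.
move=> cK /subspace_continuousP gc eps e0.
have e2 : 0 < eps / 2 by rewrite divr_gt0.
have : \forall w \near (0 : R)^'+,
    K `<=` (fun w x => forall y, K y -> ball x w y -> `|g x - g y| < eps) w.
  move/compact_near_coveringP/near_covering_withinP : cK; apply => x0 Kx0.
  have : nbhs x0 [set y | K y -> `|g x0 - g y| < eps / 2].
    by have /cvgrPdist_lt/(_ _ e2) := gc x0 Kx0.
  move=> /nbhs_ballP[r /= r0 rP].
  have r2 : 0 < r / 2 by rewrite divr_gt0.
  exists (ball x0 (r / 2), [set w : R | w < r / 2]).
    split; first exact: nbhsx_ballx.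
    exact: nbhs_right_lt.
  move=> [x w] [/= x0x wr] Kx y Ky xy.
  rewrite -(subrKA (g x0)) [eps]splitr (le_lt_trans (ler_normD _ _))// ltrD//.
    rewrite distrC; apply: rP => //; apply: le_ball x0x.
    by rewrite ler_pdivrMr// ler_peMr ?ler1n// ltW.
  apply: rP => //; rewrite [r]splitr; apply: ball_triangle x0x _.
  by apply: le_ball xy; exact: ltW.
move=> H; have [w [w0 wP]] : exists w : R, 0 < w /\
    K `<=` (fun x => forall y, K y -> ball x w y -> `|g x - g y| < eps).
  near (0 : R)^'+ => w; exists w; split; near: w; first exact: nbhs_right_gt.
  exact: H.
by exists w => // x y Kx; exact: wP.
Unshelve. all: by end_near. Qed.

Section Spheres.
Context {R : realType}.

Lemma sphere_cube k (x : 'rV[R]_k.+1) : sphere k x -> cube x.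
Proof.
rewrite /sphere /= => x1 i.
rewrite -(@ler_pXn2r _ 2)// ?nnegrE// expr1n real_normK ?num_real// -x1.
rewrite (bigD1 i)//= lerDl; apply: sumr_ge0 => j _; exact: sqr_ge0.
Qed.

Lemma sum_sqr_continuous d : continuous (fun x : 'rV[R]_d => \sum_i x ord0 i ^+ 2).
Proof.
move=> y; apply: cvg_big => [||i _]; [exact: add_continuous | exact: nbhs_filter | ].
by apply: cvgM; (exact: nbhs_filter || exact: coord_continuous).
Qed.

Lemma sphere_compact k : compact (@sphere R k).
Proof.
apply: (@subclosed_compact _ _ [set x : 'rV[R]_k.+1 | forall i, `[-1, 1]%classic (x ord0 i)]).
- rewrite (_ : sphere k = (fun x : 'rV[R]_k.+1 => \sum_i x ord0 i ^+ 2) @^-1` [set 1])//.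
  apply: closed_comp; last exact: closed_eq.
  by move=> x _; exact: sum_sqr_continuous.
- by apply: (@rV_compact R _ (fun=> `[-1, 1]%classic)) => _; exact: segment_compact.
- by move=> x /sphere_cube x1 i /=; rewrite in_itv /= -ler_norml.
Qed.

End Spheres.

Section Diameter.
Context {R : realType} {E : normedModType R}.
Implicit Types (A : set E).

Lemma diam_lt_dist A (r : R) : (diam A < r%:E)%E ->
  forall a b, A a -> A b -> `|a - b| < r.
Proof.
move=> dr a b Aa Ab; rewrite -lte_fin; apply: le_lt_trans dr.
by apply: ereal_sup_ubound; exists (a, b).
Qed.

Lemma dist_lt_diam A (c r : R) : c < r ->
  (forall a b, A a -> A b -> `|a - b| <= c) -> (diam A < r%:E)%E.
Proof.
move=> cr H; apply: (@le_lt_trans _ _ c%:E); last by rewrite lte_fin.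
by apply: ge_ereal_sup => _ [[a b] [/= Aa Ab] <-]; rewrite lee_fin; exact: H.
Qed.

End Diameter.

Section Approximation.
Context {R : realType} {E : normedModType R}.

Definition vertex (V : choiceType) (v : V) : {ptws V -> R} := fun w => (w == v)%:R.

Lemma vertex_cell (V : choiceType) (s : {fset V}) (v : V) : v \in s -> cell s (vertex v).
Proof.
move=> vs; split.
- by move=> w; rewrite /vertex; case: eqP => _; rewrite ?lexx ?ler01.
- by move=> w ws; rewrite /vertex; case: eqP => // wv; rewrite -wv (negbTE ws) in vs.
- by exists v => //; rewrite /vertex eqxx.
Qed.

(** Maps of the sphere into a small neighbourhood of a member of a uniformly
    equi-LC family can be approximated by maps into that member: triangulate
    finely, move the vertices into the member, and fill the simplices one skeleton
    after the other. The triangulation is that of the ambient space, of dimension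
    [k + 1], and filling its top simplices uses local connectedness in dimension
    [k]. The tolerance [rho j] is the one for the simplices with [j] vertices. *)
Lemma equi_LC_sphere_approximation (k : nat) (SS : set (set E)) :
  uniformly_equi_LC k SS -> forall eps : R, 0 < eps ->
  exists2 delta : R, 0 < delta & forall S, SS S -> forall g : 'rV[R]_k.+1 -> E,
    {within sphere k, continuous g} ->
    (forall x, sphere k x -> exists2 y, S y & `|g x - y| < delta) ->
    exists2 h, sphere_map S h & forall x, sphere k x -> `|g x - h x| < eps.
Proof.
move=> LC eps eps0.
(* Filling the simplices with [j + 1] vertices within [r] is possible when those
   with [j] vertices stay within [D r]: two points of the boundary are then at
   distance at most [4 * D r], and a point of the filling is within [r / 2] of a
   point of the boundary. *)
have /choice[D DP] : forall r : R, exists r' : R, 0 < r ->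
    [/\ 0 < r', r' <= r / 2 & forall S, SS S -> forall i : nat, (i <= k)%N ->
      forall f : 'rV[R]_i.+1 -> E, sphere_map S f ->
      (diam (f @` sphere i) < (5 * r')%:E)%E ->
      exists2 g, ball_extension S f g & (diam (g @` unit_ball i.+1) < (r / 2)%:E)%E].
  move=> r; have [r0|_] := ltP 0 r; last by exists 0.
  have r2 : 0 < r / 2 by rewrite divr_gt0.
  have [d d0 dP] := LC _ r2; exists (Num.min (r / 2) (d / 5)) => _; split.
  - by rewrite lt_min r2 divr_gt0.
  - by rewrite ge_min lexx.
  - move=> S SSS i ik f Sf df; apply: dP => //.
    apply: lt_le_trans df _; rewrite lee_fin -ler_pdivlMl// [X in _ <= X]mulrC.
    by rewrite ge_min lexx orbT.
pose rho j := iter (k.+2 - j) D (eps / 2).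
have rho_gt0 j : 0 < rho j.
  rewrite /rho; elim: (_ - _)%N => [|n ih]; first by rewrite divr_gt0.
  by rewrite iterS; have [] := DP _ ih.
have rhoD j : (j < k.+2)%N -> rho j = D (rho j.+1).
  by move=> jk; rewrite /rho -iterS subnS prednK// subn_gt0.
have rho_half j : (j < k.+2)%N -> rho j <= rho j.+1 / 2.
  by move=> jk; rewrite rhoD//; have [] := DP _ (rho_gt0 j.+1).
have rho_mono i j : (i <= j)%N -> (j <= k.+2)%N -> rho i <= rho j.
  move=> /subnKC <-; elim: (j - i)%N => [|n ih]; first by rewrite addn0.
  rewrite addnS => ink; apply: le_trans (ih (ltnW ink)) _.
  apply: le_trans (rho_half _ ink) _.
  by rewrite ler_pdivrMr// ler_peMr ?ler1n// ltW.
exists (rho 1%N) => // S SSS g gc gS.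
have [w w0 gw] := compact_uniform_continuity (@sphere_compact R k) gc (rho_gt0 1%N).
pose L := (Num.truncn (2 / w)).+1.
have Lw : 2 / L%:R < w.
  have /andP[_ h] := truncn_itv (ltW (divr_gt0 (ltr0n R 2) w0)).
  by rewrite ltr_pdivrMr ?ltr0n// mulrC -ltr_pdivrMr.
have [l [lc l01 l1 lord lmesh]] := @kuhn_functions R k.+1 L isT.
pose V : finType := {ffun 'I_k.+1 -> 'I_L.*2.+1}.
have g_near (v : V) x y : sphere k x -> sphere k y -> l v x != 0 -> l v y != 0 ->
    `|g x - g y| < rho 1%N.
  move=> Sx Sy lx ly; apply: gw => //; split=> // i j; rewrite ord1.
  exact: lt_trans (lmesh v x y j lx ly) Lw.
(* [c v] is a point of the sphere in the open star of the vertex [v] *)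
have /choice[c cP] : forall v : V, exists y : 'rV[R]_k.+1,
    (exists2 x, sphere k x & l v x != 0) -> sphere k y /\ l v y != 0.
  move=> v; have [[x Sx lx]|nx] := pselect (exists2 x, sphere k x & l v x != 0).
    by exists x.
  by exists 0.
pose K := [set s : {fset V} | exists2 x, sphere k x & forall v, v \in s -> l v x != 0].
have cK : simplicial_complex K.
  by move=> s s' /fsubsetP ss' [x Sx lx]; exists x => // v /ss'; exact: lx.
have Kcard s : K s -> (#|` s| <= k.+2)%N by move=> [x _ /lord].
have Kc s v : K s -> v \in s -> sphere k (c v) /\ l v (c v) != 0.
  by move=> [x Sx lx] vs; apply: cP; exists x => //; exact: lx.
have K_near s a b : K s -> a \in s -> b \in s -> `|g (c a) - g (c b)| < 2 * rho 1%N.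
  move=> Ks ha hb; have [Sa la] := Kc s a Ks ha; have [Sb lb] := Kc s b Ks hb.
  have [x Sx lx] := Ks; rewrite -(subrKA (g x)) (le_lt_trans (ler_normD _ _))//.
  by rewrite mulrDl !mul1r ltrD//; [apply: (g_near a) => //; exact: lx
    | apply: (g_near b) => //; exact: lx].
pose P (s : {fset V}) (A : set E) := A `<=` S /\
  forall v a, v \in s -> A a -> `|a - g (c v)| < rho #|` s|.
have [||s u Ks _ s0 uc uP|u [_ uc uP]] :=
  @skeleton_extension R V E set0 K P k.+2 (fun=> 0) (fun _ _ _ => id) cK (@sub0set _ K) Kcard.
- by move=> s [].
- by move=> s [].
- case sj : #|` s| => [|[|j]].
  + by move: s0; rewrite -cardfs_gt0 sj.
  + move/eqP/cardfs1P : (sj) => [v sv].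
    have [Scv _] : sphere k (c v) /\ l v (c v) != 0 by apply: (Kc s); rewrite // sv inE.
    have [y Sy gy] := gS _ Scv; exists (fun=> y); split.
    * by apply: continuous_subspaceT; exact: cst_continuous.
    * move=> t; rewrite sv => -[[_ _ [a]]].
      rewrite inE => /eqP -> tv [b]; rewrite inE => /eqP ->.
      by rewrite tv => /eqP; rewrite oner_eq0.
    * split=> [_ [_ _ <-]//|a b]; rewrite sv inE => /eqP -> [_ _ <-].
      by rewrite distrC cardfs1.
  + have jk : (j < k.+1)%N by have := Kcard s Ks; rewrite sj.
    have facet v : v \in s -> [/\ #|` (s `\ v)%fset| = j.+1 &
        P (s `\ v)%fset (u @` cell (s `\ v)%fset)].
      move=> vs; have cardv : #|` (s `\ v)%fset| = j.+1.
        by have := finmap.cardfsD1 v s; rewrite vs sj add1n => -[].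
      by split=> //; apply: uP; [exact: fproperD1 | rewrite -cardfs_gt0 cardv].
    have facet_vertex v : v \in s -> exists2 a, a \in s & a \in (s `\ v)%fset.
      move=> /facet[cardv _]; have /fset0Pn[a av] : (s `\ v)%fset != fset0.
        by rewrite -cardfs_gt0 cardv.
      by exists a => //; move: av; rewrite !inE => /andP[].
    have u_near t : cell_boundary s t -> exists2 a, a \in s & `|u t - g (c a)| < rho j.+1.
      move=> /cell_boundaryP[v vs vt]; have [a ha hav] := facet_vertex v vs.
      exists a => //; have [cardv [_ H]] := facet v vs.
      by rewrite -cardv; apply: H => //; exists t.
    have [f [fc fu fill]] := cell_extension sj uc.
    have fS : f @` sphere j `<=` S.
      move=> _ /fu [t /cell_boundaryP[v vs vt] <-].
      by have [_ [sub _]] := facet v vs; apply: sub; exists t.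
    have jk2 : (j.+1 < k.+2)%N by [].
    have [D0 D2 DLC] := DP _ (rho_gt0 j.+2); rewrite -rhoD// in D0 D2 DLC.
    have df : (diam (f @` sphere j) < (5 * rho j.+1)%:E)%E.
      apply: (@dist_lt_diam _ _ _ (4 * rho j.+1)).
        by rewrite ltr_pM2r// ltr_nat.
      move=> _ _ /fu [t /u_near[a ha ta] <-] /fu [t' /u_near[b hb tb] <-].
      have ab := K_near s a b Ks ha hb.
      have r1 : rho 1%N <= rho j.+1 by apply: rho_mono => //; exact: ltnW.
      have -> : u t - u t' = (u t - g (c a)) + (g (c a) - g (c b)) + (g (c b) - u t').
        by rewrite !subrKA.
      apply: le_trans (ler_normD _ _) _; rewrite (distrC (g (c b))).
      apply: le_trans (lerD (ler_normD _ _) (lexx _)) _.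
      lra.
    have [g' [g'c g'S g'f] dg'] := DLC S SSS j jk f (conj fc fS) df.
    have [u' [u'c u'u u'g]] := fill g' g'c g'f.
    exists u'; split=> //; split; first exact: subset_trans u'g g'S.
    move=> v a vs /u'g ga; rewrite sj.
    have [b hb hbv] := facet_vertex v vs.
    have vb : v \in (s `\ b)%fset.
      by move: hbv; rewrite !inE vs andbT hb andbT eq_sym.
    have vt : cell_boundary s (vertex v).
      by apply/cell_boundaryP; exists b => //; exact: vertex_cell.
    have [cardb [_ H]] := facet b hb.
    have uv : `|u (vertex v) - g (c v)| < rho j.+1.
      by rewrite -cardb; apply: H => //; exists (vertex v) => //; exact: vertex_cell.
    have av : `|a - u (vertex v)| < rho j.+2 / 2.
      apply: (diam_lt_dist dg') => //; apply: u'g; exists (vertex v); last exact: u'u.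
      exact: vertex_cell.
    rewrite -(subrKA (u (vertex v))); apply: le_lt_trans (ler_normD _ _) _.
    by rewrite [rho j.+2]splitr ltrD// (lt_le_trans uv).
pose lam x : {ptws V -> R} := fun v => l v x.
pose car x := fset_set [set v : V | l v x != 0].
have mem_car x v : (v \in car x) = (l v x != 0).
  rewrite in_fset_set; last exact: finite_finset.
  by apply/idP/idP => [/set_mem|]; [|move=> h; apply/mem_set].
have lamK x : sphere k x -> K (car x) /\ cell (car x) (lam x).
  move=> Sx; split; first by exists x => // v; rewrite mem_car.
  split=> [v|v|]; [exact: l01 | by rewrite mem_car negbK => /eqP |].
  have [v lv] := l1 x (sphere_cube Sx).
  by exists v => //; rewrite mem_car lv oner_eq0.
have car0 x : sphere k x -> car x != fset0.
  move=> Sx; have [_ [_ _ [v vx _]]] := lamK x Sx.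
  by apply/fset0Pn; exists v.
exists (u \o lam); first split.
- apply: (complex_map_continuous cK uc) => [|x Sx|x Sx].
  + apply/subspace_continuousP => x Sx.
    apply: (@cvg_pointwise _ _ _ _ lam (lam x)) => v.
    apply: cvg_trans (lc v x (sphere_cube Sx)).
    by apply: cvg_fmap2; apply: cvg_within.
  + by exists (car x); case: (lamK x Sx).
  + by exists setT; [exact: filterT | exact: finite_finset].
- move=> _ [x Sx <-]; have [Kx xl] := lamK x Sx; have [sub _] := uP _ Kx (car0 x Sx).
  by apply: sub; exists (lam x).
- move=> x Sx; have [Kx xl] := lamK x Sx; have [_ H] := uP _ Kx (car0 x Sx).
  have /fset0Pn[v vx] := car0 x Sx; have [Sv lv] := Kc _ _ Kx vx.
  rewrite -(subrKA (g (c v))); apply: le_lt_trans (ler_normD _ _) _.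
  have rk i : (i <= k.+2)%N -> rho i <= eps / 2.
    by move=> ik; have := rho_mono i k.+2 ik (leqnn _); rewrite {2}/rho subnn.
  rewrite [eps]splitr ltrD//.
    apply: lt_le_trans (rk 1%N isT); apply: (g_near v) => //.
    by rewrite -mem_car.
  rewrite distrC; apply: lt_le_trans (rk _ (Kcard _ Kx)).
  by apply: H => //; exists (lam x).
Qed.

End Approximation.

(** * Enlargements and the selection theorem *)

Section Enlargement.
Context {R : realType} {E : normedModType R}.

Definition enlargement (e : R) (S : set E) : set E :=
  [set y | exists2 a, S a & `|y - a| < e].

Lemma enlargement_stable (X : topologicalType) (Phi : X -> set E) (e : R)
    (K : set E) (x : X) : mapping_lsc Phi -> compact K ->
  K `<=` enlargement e (Phi x) -> \forall y \near x, K `<=` enlargement e (Phi y).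
Proof.
move=> lsc cK Kx.
apply: ((compact_near_coveringP K).1 cK X (nbhs x)
  (fun y z => enlargement e (Phi y) z)) => z Kz.
have [a Pa za] := Kx z Kz.
have r0 : 0 < (e - `|z - a|) / 2 by rewrite divr_gt0// subr_gt0.
exists (ball z ((e - `|z - a|) / 2),
  [set y | Phi y `&` ball a ((e - `|z - a|) / 2) !=set0]).
  split; first exact: nbhsx_ballx.
  apply: open_nbhs_nbhs; split; first by apply: lsc; exact: ball_open.
  by exists a; split=> //; exact: ballxx.
move=> [z' y] [/= zz' [b [Pb ab]]]; exists b => //.
move: zz' ab; rewrite -!ball_normE /= => zz' ab.
rewrite -(subrKA z) -[z - b](subrKA a); apply: le_lt_trans (ler_normD _ _) _.
have := ler_normD (z - a) (a - b); rewrite distrC in zz'; lra.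
Qed.

(** A map of the sphere into the enlargement of [S] is joined linearly, in the
    outer half of the ball, to a close map into [S], which is extended over the
    inner half. *)
Lemma enlargement_extends (k : nat) (S S' : set E) (delta e : R) : 0 < e ->
  (forall g : 'rV[R]_k.+1 -> E, {within sphere k, continuous g} ->
    (forall x, sphere k x -> enlargement delta S (g x)) ->
    exists2 h, sphere_map S h & forall x, sphere k x -> `|g x - h x| < e) ->
  sphere_extends k S S' ->
  forall f : 'rV[R]_k.+1 -> E, sphere_map (enlargement delta S) f ->
  exists g, ball_extension (enlargement e S') f g.
Proof.
move=> e0 approx ext f [fc fS].
have [|h [hc hS] fh] := approx f fc; first by move=> x Sx; apply: fS; exists x.
have [H [Hc HS' Hh]] := ext h (conj hc hS).
pose n (z : 'rV[R]_k.+1) : R := Num.sqrt (\sum_i z ord0 i ^+ 2).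
have n_ge0 z : 0 <= n z by exact: sqrtr_ge0.
have n_sqr z : n z ^+ 2 = \sum_i z ord0 i ^+ 2.
  by rewrite sqr_sqrtr//; apply: sumr_ge0 => i _; exact: sqr_ge0.
have nc : continuous n.
  move=> z; apply: continuous_comp; last exact: sqrt_continuous.
  exact: sum_sqr_continuous.
have sqrZ (c : R) (z : 'rV[R]_k.+1) : \sum_i (c *: z) ord0 i ^+ 2 = (c * n z) ^+ 2.
  rewrite exprMn n_sqr mulr_sumr; apply: eq_bigr => i _.
  by rewrite mxE exprMn.
have n_sphere z : sphere k z -> n z = 1 by rewrite /sphere /n /= => ->; rewrite sqrtr1.
have n_ball z : unit_ball k.+1 z -> n z <= 1.
  by rewrite /unit_ball /= -n_sqr expr_le1.
(* [clip] maps the inner half-ball onto the ball and is the radial projection to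
   the sphere outside, where [c] increases from 0 to 1. *)
pose clip (z : 'rV[R]_k.+1) := (2 / Num.max 1 (2 * n z)) *: z.
pose c z := Num.max 0 (2 * n z - 1).
pose dir (z : 'rV[R]_k.+1) := (n z)^-1 *: z.
have den_gt0 z : 0 < Num.max 1 (2 * n z) by rewrite lt_max ltr01.
have affine_c (a b : R) : continuous (fun z => a * n z + b).
  move=> z; have FF := nbhs_filter z.
  exact: (@cvgD _ _ _ _ FF _ _ _ _ (@cvgM _ _ _ FF _ _ _ _ (@cvg_cst R a _ _ FF) (@nc z))
    (@cvg_cst R b _ _ FF)).
have cst_c (a : R) : continuous ((fun=> a) : 'rV[R]_k.+1 -> R) by exact: cst_continuous.
have den_c : continuous (fun z => Num.max 1 (2 * n z)).
  have -> : (fun z => Num.max 1 (2 * n z)) = (fun z => Num.max 1 (2 * n z + 0)).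
    by apply/funext => z; rewrite addr0.
  exact: (max_fun_continuous (cst_c 1) (affine_c 2 0)).
have c_c : continuous c by exact: (max_fun_continuous (cst_c 0) (affine_c 2 (-1))).
have clip_c : continuous clip.
  move=> z; have FF := nbhs_filter z.
  exact: (@cvgZ _ _ _ _ FF _ _ _ _ (@cvgM _ _ _ FF _ _ _ _ (@cvg_cst R 2 _ _ FF)
    (@cvgV _ _ _ FF _ _ (lt0r_neq0 (den_gt0 z)) (@den_c z))) (@cvg_id _ (nbhs z))).
have clip_ball z : unit_ball k.+1 (clip z).
  rewrite /unit_ball /= sqrZ expr_le1//; last first.
    by rewrite mulr_ge0// divr_ge0// ltW.
  by rewrite mulrAC ler_pdivrMr// mul1r le_max lexx orbT.
have dir_sphere z : 0 < n z -> sphere k (dir z).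
  by move=> nz; rewrite /sphere /= sqrZ mulVf ?expr1n// gt_eqF.
have dir_c : {within [set z | 0 < n z], continuous dir}.
  apply: continuous_in_subspaceT => z /set_mem /= nz; have FF := nbhs_filter z.
  exact: (@cvgZ _ _ _ _ FF _ _ _ _
    (@cvgV _ _ _ FF _ _ (lt0r_neq0 nz) (@nc z)) (@cvg_id _ (nbhs z))).
pose q z := c z *: (f (dir z) - h (dir z)).
have q_c : continuous q.
  move=> z; have FF := nbhs_filter z; have [nz|nz] := ltP (n z) (1 / 2).
    have q0 : \forall y \near z, q y = 0.
      near=> y; rewrite /q /c max_l ?scale0r//.
      have : n y < 1 / 2 by near: y; exact: (cvgr_lt _ (@nc z)).
      lra.
    rewrite /continuous_at (nbhs_singleton q0).
    apply: cvg_trans (@cvg_cst E 0 _ (nbhs z) FF); apply: near_eq_cvg.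
    by apply: filterS q0 => y ->.
  have nz0 : 0 < n z by apply: lt_le_trans nz; lra.
  have oA : open [set z | 0 < n z].
    have -> : [set z | 0 < n z] = n @^-1` [set r | 0 < r] by [].
    by apply: open_comp; [move=> y _; exact: nc | exact: open_gt].
  have sub : dir @` [set z | 0 < n z] `<=` sphere k.
    by move=> _ [y /= ny <-]; exact: dir_sphere.
  have at_z (g : 'rV[R]_k.+1 -> E) : {within sphere k, continuous g} ->
      (fun y => g (dir y)) @ nbhs z --> g (dir z).
    move=> gc; have := within_continuous_comp_within dir_c sub gc.
    by rewrite continuous_open_subspace// => /(_ z (mem_set nz0)).
  exact: (@cvgZ _ _ _ _ FF _ _ _ _ (@c_c z) (@cvgB _ _ _ _ FF _ _ _ _ (at_z f fc) (at_z h hc))).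
have Hclip_c : continuous (H \o clip).
  apply/continuous_subspace_setT; apply: within_continuous_comp_within Hc.
    exact: continuous_subspaceT.
  by move=> _ [z _ <-].
exists (fun z => H (clip z) + q z); split.
- apply: continuous_subspaceT => z; have FF := nbhs_filter z.
  exact: (@cvgD _ _ _ _ FF _ _ _ _ (@Hclip_c z) (@q_c z)).
- move=> _ [z /n_ball nz1 <-]; exists (H (clip z)); first by apply: HS'; exists (clip z).
  rewrite addrAC subrr add0r /q /c normrZ.
  have [nz|nz] := leP (2 * n z - 1) 0; first by rewrite normr0 mul0r.
  rewrite (gtr0_norm nz).
  have nz0 : 0 < n z by lra.
  apply: le_lt_trans (fh _ (dir_sphere z nz0)).
  by rewrite ler_piMl//; lra.
- move=> z Sz; have n1 := n_sphere z Sz.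
  have -> : clip z = z by rewrite /clip n1 mulr1 max_r ?divff ?scale1r// ler1n.
  have -> : q z = f z - h z.
    rewrite /q /c /dir n1 invr1 scale1r mulr1 max_r; last by lra.
    by rewrite (_ : 2 - 1 = 1) ?scale1r//; lra.
  by rewrite Hh// addrC subrK.
Unshelve. all: by end_near. Qed.

End Enlargement.

(* The natural number N stands for n + 1, so that n >= -1 is N >= 0 and
   0 <= k <= n is k < N. *)
Theorem theorem5p4 (R : realType) (N : nat) (X : topologicalType)
    (hausdorffX : hausdorff_space X)
    (paracompactX : paracompact X)
    (dimX : covering_dim_le X N)
    (E : completeNormedModType R)
    (Phi : nat -> X -> set E)
    (Phi_nonempty : forall k, (k <= N)%N -> forall x, Phi k x !=set0)
    (Phi_lsc : forall k, (k <= N)%N -> mapping_lsc (Phi k))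
    (Phi_LC : forall k, (k < N)%N -> uniformly_equi_LC k (range (Phi k)))
    (Phi_ext : forall k, (k < N)%N ->
       forall x, sphere_extends k (Phi k x) (Phi k.+1 x)) :
  forall eps : R, 0 < eps ->
    exists2 f : X -> E, continuous f & eps_selection eps (Phi N) f.
Proof.
move=> eps eps0.
have /choice[D DP] : forall kr : nat * R, exists d : R, (kr.1 < N)%N -> 0 < kr.2 ->
    0 < d /\ forall x (g : 'rV[R]_kr.1.+1 -> E), {within sphere kr.1, continuous g} ->
      (forall y, sphere kr.1 y -> enlargement d (Phi kr.1 x) (g y)) ->
      exists2 h, sphere_map (Phi kr.1 x) h &
        forall y, sphere kr.1 y -> `|g y - h y| < kr.2.
  move=> [k r] /=.
  have [[kN r0]|nkr] := pselect ((k < N)%N /\ 0 < r); last first.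
    by exists 0 => kN r0; exfalso; apply: nkr.
  have [d d0 dP] := equi_LC_sphere_approximation (Phi_LC k kN) r0.
  by exists d => _ _; split=> // x; apply: dP; exists x.
(* [a j] is the radius [e (N - j)]; the radii are chosen from [N] downwards *)
pose a := fix a j := if j is j'.+1 then D ((N - j)%N, a j') else eps.
have a_gt0 j : (j <= N)%N -> 0 < a j.
  elim: j => [//|j ih] jN /=; have [] := DP ((N - j.+1)%N, a j) => //=.
  - by rewrite ltn_subrL (leq_trans _ jN).
  - by apply: ih; exact: ltnW.
pose e k := a (N - k)%N.
have e_gt0 k : 0 < e k by apply: a_gt0; exact: leq_subr.
have eD k : (k < N)%N -> e k = D (k, e k.+1).
  move=> kN; have NkS : (N - k = (N - k.+1).+1)%N by rewrite subnSK.
  by rewrite /e [in LHS]NkS /= -NkS subKn// ltnW.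
pose Psi k x := enlargement (e k) (Phi k x).
have Psi_nonempty x : Psi 0%N x !=set0.
  have [y Py] := Phi_nonempty 0%N (leq0n N) x.
  by exists y, y => //; rewrite subrr normr0.
have Psi_stable k x (K : set E) : (k <= N)%N -> compact K -> K `<=` Psi k x ->
    \forall y \near x, K `<=` Psi k y.
  by move=> kN; exact: enlargement_stable (Phi_lsc k kN).
have Psi_extends k x : (k < N)%N -> forall f : 'rV[R]_k.+1 -> E,
    sphere_map (Psi k x) f -> exists g, ball_extension (Psi k.+1 x) f g.
  move=> kN; apply: enlargement_extends (Phi_ext k kN x) => //.
  have [_ /(_ x)] := DP (k, e k.+1) kN (e_gt0 _).
  by rewrite /= -eD.
have [f fc fP] := stable_selection hausdorffX paracompactX dimX
  Psi_nonempty Psi_stable Psi_extends.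
exists f => // x; have [y Py fy] := fP x.
by exists y => //; move: fy; rewrite /e subnn.
Qed.
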